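(* Let $N>2$ be an integer. Let $\mathcal{P}_N$ be the $N$-gonal arrangement and $\overline{\mathcal{P}_N}$ the complete $N$-gonal arrangement. Then $\mathcal{P}_N$ is always supersolvable, and $\overline{\mathcal{P}_N}$ is supersolvable if and only if $N$ is even. Moreover, $\mathcal{P}_N$ never admits an unexpected curve, but if $N$ is even, then $\overline{\mathcal{P}_N}$ admits a unique unexpected curve and its degree is $N$.
   Context: Polygonal arrangements: consider a regular polygon with $N\geq 3$ edges in the real affine plane, viewed inside the projective plane. Let $e_1,\dots,e_N$ be the lines spanned by the sides of the polygon, $m_1,\dots,m_N$ the symmetry axes of the polygon, and $\ell_\infty$ the line at infinity. The $N$-gonal arrangement is $\mathcal{P}_N=\{e_1,\dots,e_N,m_1,\dots,m_N\}$ and the complete $N$-gonal arrangement is $\overline{\mathcal{P}_N}=\mathcal{P}_N\cup\{\ell_\infty\}$. They are regarded as line arrangements in $\mathbb{P}^2=\mathbb{P}^2_{\mathbb{C}}$. A line arrangement is a finite set $\mathcal{A}$ of distinct lines in the projective plane. $\mathrm{Sing}(\mathcal{A})$ is the set of points where at least two lines of $\mathcal{A}$ meet. $\mathcal{A}$ is supersolvable if it has a modular point, i.e. a point $P$ such that for every $Q\in\mathrm{Sing}(\mathcal{A})$ (with $Q\neq P$) the line joining $P$ and $Q$ belongs to $\mathcal{A}$. Duality: the line $\{p_0y_0+p_1y_1+p_2y_2=0\}$ is dual to the point $(p_0:p_1:p_2)$; the dual configuration of $\mathcal{A}$ is the set $Z$ of points dual to the lines of $\mathcal{A}$. Unexpected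 curves: let $S=\mathbb{C}[x_0,x_1,x_2]$ with the standard grading; for a homogeneous ideal $I$ write $[I]_i$ for its degree $i$ part. For a finite set $Z$ of reduced points in $\mathbb{P}^2$ with homogeneous ideal $I(Z)$, a point $Q$ with ideal $I(Q)$ and an integer $j$, put $I(Z+jQ)=I(Z)\cap I(Q)^j$. The set $Z$ admits unexpected curves of degree $j+1$ if for a general point $Q\in\mathbb{P}^2$ one has $\dim_{\mathbb{C}}[I(Z+jQ)]_{j+1}>\max\{\dim_{\mathbb{C}}[I(Z)]_{j+1}-\binom{j+1}{2},0\}$; in this case the unexpected curves of degree $j+1$ are the curves defined by nonzero elements of $[I(Z+jQ)]_{j+1}$, for $Q$ general. $Z$ admits unexpected curves if it does so in some degree. ''A unique unexpected curve, of degree $N$'' means that $Z$ admits unexpected curves in degree $N$ only, and for general $Q$ there is exactly one curve of degree $N$ in that system, i.e. $\dim_{\mathbb{C}}[I(Z+(N-1)Q)]_{N}=1$. A line arrangement is said to admit unexpected curves if its dual configuration of points does. *)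

(* Defs.v *)
From HB Require Import structures.
From mathcomp Require Import all_boot all_order all_algebra.
From mathcomp Require Import boolp classical_sets reals trigo complex mpoly.

Set Implicit Arguments.
Unset Strict Implicit.
Unset Printing Implicit Defensive.

Import Order.TTheory GRing.Theory Num.Theory.

Local Open Scope classical_set_scope.
Local Open Scope complex_scope.
Local Open Scope ring_scope.

Section ProjectivePlane.
Variable K : fieldType.

(* P^2 over K: the one-dimensional subspaces of K^3, so that Leibniz equality
   is equality of points. *)
Record point := Point {
  point_vs :> {vspace 'rV[K]_3};
  _ : \dim point_vs == 1%N }.

HB.instance Definition _ := [isSub for point_vs].
HB.instance Definition _ := [Choice of point by <:].

(* A line is given by its equation up to scaling, i.e. by the dual point:
   {p_0 y_0 + p_1 y_1 + p_2 y_2 = 0} has dual point (p_0 : p_1 : p_2). *)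
Record line := Line { dual_point : point }.

Definition on_line (P : point) (L : line) : Prop :=
  forall v w : 'rV[K]_3, v \in point_vs P -> w \in point_vs (dual_point L) ->
    \sum_(i < 3) w 0 i * v 0 i = 0.

Definition vec3 (a b c : K) : 'rV[K]_3 := \row_(i < 3) [:: a; b; c]`_i.

Definition sing (A : set line) : set point :=
  [set Q | exists L M : line,
     [/\ A L, A M, L <> M, on_line Q L & on_line Q M]].

Definition modular_point (A : set line) (P : point) : Prop :=
  forall Q, sing A Q -> Q <> P ->
    exists L, [/\ A L, on_line P L & on_line Q L].

Definition supersolvable (A : set line) : Prop :=
  exists P, modular_point A P.

Definition dual_configuration (A : set line) : set point := dual_point @` A.

Local Notation S := {mpoly K[3]}.

(* The homogeneous ideal of Z: the polynomials vanishing on the cone over Z.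
   This is the ideal generated by the forms vanishing on Z when K is
   infinite. *)
Definition ideal_of (Z : set point) : set S :=
  [set p | forall P v, Z P -> v \in point_vs P -> p.@[v 0] = 0].

Definition ideal_mul (I J : set S) : set S :=
  [set p | exists2 s : seq (S * S),
     (forall u, u \in s -> I u.1 /\ J u.2) & p = \sum_(u <- s) u.1 * u.2].

Definition ideal_exp (I : set S) (j : nat) : set S :=
  iter j (ideal_mul I) setT.

(* I(Z + jQ) *)
Definition fat_ideal (Z : set point) (j : nat) (Q : point) : set S :=
  ideal_of Z `&` ideal_exp (ideal_of [set Q]) j.

(* [I]_d, as a subspace of the space of forms of degree d; see degree_partP. *)
Definition degree_part (I : set S) (d : nat) : {vspace dhomog 3 K d} :=
  xget 0%VS
    [set U : {vspace dhomog 3 K d} |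
       forall f : dhomog 3 K d, f \in U <-> I (f : S)].

Definition subspace (I : set S) : Prop :=
  I 0 /\ forall (a : K) p q, I p -> I q -> I (a *: p + q).

Lemma degree_partP (I : set S) d (f : dhomog 3 K d) :
  subspace I -> f \in degree_part I d <-> I (f : S).
Proof.
move=> [I0 Ilin]; rewrite /degree_part; case: xgetP => [U -> /(_ f)//|noU].
pose P n := `[< exists2 U : {vspace dhomog 3 K d},
  \dim U = n & forall g, g \in U -> I (g : S) >].
have P0 : exists n, P n.
  exists 0%N; apply/asboolP; exists 0%VS; first by rewrite dimv0.
  by move=> g; rewrite memv0 => /eqP ->; rewrite raddf0.
have Pmax n : P n -> (n <= \dim {: dhomog 3 K d})%N.
  by move=> /asboolP[U <- _]; rewrite dimvS ?subvf.
case: (ex_maxnP P0 Pmax) => n /asboolP[U dimU UI] maxn.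
exfalso; apply: (noU U) => g; split=> [/UI//|Ig].
apply: contrapT => /negP gU.
have /maxn : P (\dim (U + <[g]>)%VS).
  apply/asboolP; exists (U + <[g]>)%VS => // h /memv_addP[u uU [v /vlineP[a ->] ->]].
  by rewrite addrC raddfD /=; apply: (Ilin a g u) => //; apply: UI.
rewrite leqNgt -dimU => /negP; apply.
rewrite ltn_neqAle dimvS ?addvSl // andbT; apply: contraNneq gU => dimE.
have /eqP -> : U == (U + <[g]>)%VS by rewrite eqEdim addvSl -dimE leqnn.
by rewrite (subvP (addvSr _ _)) // memv_line.
Qed.

Lemma subspace_ideal_of (Z : set point) : subspace (ideal_of Z).
Proof.
split=> [P v _ _|a p q Ip Iq P v ZP vP]; first by rewrite meval0.
by rewrite mevalD mevalZ (Ip _ _ ZP vP) (Iq _ _ ZP vP) mulr0 addr0.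
Qed.

Lemma subspace_ideal_exp (Z : set point) j :
  subspace (ideal_exp (ideal_of Z) j).
Proof.
case: j => [|j]; first by split.
rewrite /ideal_exp iterS; split=> [|a p q [s sI ->] [t tI ->]].
  by exists [::]; rewrite ?big_nil.
exists ([seq (a *: u.1, u.2) | u <- s] ++ t); last first.
  by rewrite big_cat big_map scaler_sumr; congr (_ + _);
     apply: eq_bigr => u _; rewrite scalerAl.
move=> u; rewrite mem_cat => /orP[/mapP[w /sI[Iw Jw] ->]|/tI//]; split=> //=.
have [I0 Ilin] := subspace_ideal_of Z.
by rewrite -[_ *: _]addr0; apply: Ilin.
Qed.

Lemma subspace_fat_ideal (Z : set point) j (Q : point) :
  subspace (fat_ideal Z j Q).
Proof.
have [I0 Ilin] := subspace_ideal_of Z.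
have [J0 Jlin] := subspace_ideal_exp [set Q] j.
by split=> // a p q [Ip Jp] [Iq Jq]; split; [apply: Ilin|apply: Jlin].
Qed.

(* T holds for a general point: on the complement of some plane curve, hence
   on a nonempty Zariski-open set when K is infinite. *)
Definition general (T : point -> Prop) : Prop :=
  exists d (g : dhomog 3 K d), g <> 0 /\
    forall Q : point, ~ ideal_of [set Q] (g : S) -> T Q.

(* Subtraction on nat is truncated, so the right-hand side below is
   max {dim [I(Z)]_(j+1) - binom(j+1, 2), 0}. *)
Definition unexpected (Z : set point) (j : nat) : Prop :=
  general (fun Q =>
    (\dim (degree_part (fat_ideal Z j Q) j.+1) >
     \dim (degree_part (ideal_of Z) j.+1) - 'C(j.+1, 2))%N).

Definition admits_unexpected_in_degree (A : set line) (d : nat) : Prop :=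
  exists2 j, d = j.+1 & unexpected (dual_configuration A) j.

Definition admits_unexpected (A : set line) : Prop :=
  exists d, admits_unexpected_in_degree A d.

Definition admits_unique_unexpected (A : set line) (d : nat) : Prop :=
  (forall d', admits_unexpected_in_degree A d' <-> d' = d) /\
  general (fun Q =>
    \dim (degree_part (fat_ideal (dual_configuration A) d.-1 Q) d) = 1%N).

End ProjectivePlane.

Section Polygon.
Variable R : realType.

(* The affine plane is embedded in P^2 by (x, y) |-> (1 : x : y). *)
Lemma dim_affine_point (u : R * R) :
  \dim <[vec3 1 u.1%:C u.2%:C]>%VS == 1%N.
Proof.
rewrite dim_vline eqb1; apply/eqP => /matrixP/(_ 0 0).
by rewrite !mxE /= => /eqP; rewrite oner_eq0.
Qed.

Definition affine_point (u : R * R) : point R[i] := Point (dim_affine_point u).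

Definition polygon_vertex (N : nat) (c : R * R) (r t : R) (k : nat) : R * R :=
  (c.1 + r * cos (t + 2 * pi * k%:R / N%:R),
   c.2 + r * sin (t + 2 * pi * k%:R / N%:R)).

Definition polygon_vertices (N : nat) (c : R * R) (r t : R) : set (R * R) :=
  [set polygon_vertex N c r t k | k in [set k | (k < N)%N]].

(* The orthogonal reflection across the line {a x + b y + e = 0}. *)
Definition reflection (a b e : R) (u : R * R) : R * R :=
  let s := 2 * (a * u.1 + b * u.2 + e) / (a ^+ 2 + b ^+ 2) in
  (u.1 - s * a, u.2 - s * b).

Definition side_lines (N : nat) (c : R * R) (r t : R) : set (line R[i]) :=
  [set L | exists2 k, (k < N)%N &
     on_line (affine_point (polygon_vertex N c r t k)) L /\
     on_line (affine_point (polygon_vertex N c r t k.+1)) L].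

Definition symmetry_axes (N : nat) (c : R * R) (r t : R) : set (line R[i]) :=
  [set L | exists a b e : R,
     [/\ (a, b) <> (0, 0),
         reflection a b e @` polygon_vertices N c r t =
           polygon_vertices N c r t &
         point_vs (dual_point L) = <[vec3 e%:C a%:C b%:C]>%VS]].

Definition line_at_infinity : set (line R[i]) :=
  [set L | point_vs (dual_point L) = <[vec3 1 0 0]>%VS].

(* The regular N-gon is the one with center c, circumradius r, and a vertex in
   the direction of angle t. *)
Definition polygonal (N : nat) (c : R * R) (r t : R) : set (line R[i]) :=
  side_lines N c r t `|` symmetry_axes N c r t.

Definition complete_polygonal (N : nat) (c : R * R) (r t : R) :
    set (line R[i]) :=
  polygonal N c r t `|` line_at_infinity.

End Polygon.

(* Main.v *)
From HB Require Import structures.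
From mathcomp Require Import all_boot all_order all_algebra.
From mathcomp Require Import boolp classical_sets reals trigo complex mpoly.
From mathcomp Require Import zify ring.
Require Import Defs.

Set Implicit Arguments.
Unset Strict Implicit.
Unset Printing Implicit Defensive.
Import Order.TTheory GRing.Theory Num.Theory.
Local Open Scope classical_set_scope.
Local Open Scope ring_scope.

(** Dually, a polygonal arrangement is a set of points in the plane.  In complex
    coordinates adapted to the polygon, the sides become the [N] points
    [(1 : x : 1/x)] of a conic, the axes the [N] points [(0 : 1 : - x)] of a
    line, with [x] an [N]-th root of unity, and the line at infinity becomes
    [(1 : 0 : 0)] ([polygonal_dual], [complete_polygonal_dual]).  The pencil of
    lines through the centre of the polygon is dual to the line of the axes.

    Supersolvability.  The line joining two sides [x], [y] meets the line of the
    axes in the axis [1/(x y)], so the centre is a modular point; the line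
    joining a side [x] to [(1 : 0 : 0)] meets it in the parameter [- 1/x^2],
    which is an [N]-th root of unity exactly when [N] is even
    ([center_modular]).  For odd [N] this failure excludes every point of the
    plane ([complete_not_supersolvable]).

    Upper bounds.  A form of degree [j + 1] with multiplicity [j] at [Q] is made
    of its restriction to the line of the axes, a binary form of degree [j + 1],
    and, once this is zero, of a binary form of degree [j] on the pencil of
    lines through [Q].  The axes impose [N] roots on the former.  The other
    points, [N] or [N + 1] in number, lie on distinct lines through a general
    [Q] and impose as many roots on the latter.  Hence the space of these forms
    has dimension at most [max (j + 2 - N, 0) + max (j + 1 - M, 0)] with [M = N]
    or [M = N + 1] ([dim_fat_le], [general_dim_fat_le]).  As the points impose
    at most as many conditions on all forms of degree [j + 1] as there are
    points, this excludes unexpected curves for the polygonal arrangement in all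
    degrees, and for the complete one in all degrees other than [N]
    ([polygonal_not_unexpected], [complete_unexpected_degree]).

    Existence.  For [j + 1 = N] and the complete arrangement, the bound is one
    while the expected dimension is zero ([complete_conditions_independent]).
    For even [N] the bound is attained by an explicit form: with [(Z, U, V)] the
    cross product of [(z, u, v)] and [Q], and [D] the Dickson polynomial with
    [D (a + b, a b) = a^(N-1) + b^(N-1)], take
    [u V^(N-1) + v U^(N-1) + z D (Z, U V)] ([unexpected_form]).  As
    [z Z + u U + v V = 0], Dickson's identity makes it vanish at the sides. *)

(** * Nonvanishing of polynomials *)

Lemma poly_neq0_nonroot (K : numFieldType) (p : {poly K}) :
  p != 0 -> exists x, p.[x] != 0.
Proof.
move=> p0; pose rs := [seq i%:R | i <- iota 0 (size p)] : seq K.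
have urs : uniq rs.
  by rewrite map_inj_uniq ?iota_uniq // => a b /eqP; rewrite eqr_nat => /eqP.
case: (boolP (all (root p) rs)) => [ars|/allPn[x _ xr]]; last by exists x.
by have := max_poly_roots p0 ars urs; rewrite size_map size_iota ltnn.
Qed.

Lemma quadratic_eq0 (K : fieldType) (s : seq K) (a b c : K) :
  uniq s -> (2 < size s)%N ->
  (forall x, x \in s -> a * x ^+ 2 + b * x + c = 0) ->
  [/\ a = 0, b = 0 & c = 0].
Proof.
move=> us s3 q0; pose g : {poly K} := a *: 'X^2 + b *: 'X + c%:P.
have g0 : g = 0.
  apply: contraTeq s3 => g0; rewrite -leqNgt.
  have gs : all (root g) s.
    apply/allP => x /q0 xE; rewrite /root /g !hornerD !hornerZ hornerXn hornerX.
    by rewrite hornerC xE.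
  rewrite -ltnS; apply: leq_trans (max_poly_roots g0 gs us) _.
  rewrite /g (leq_trans (size_polyD _ _)) // geq_max.
  rewrite (leq_trans (size_polyC_leq1 _)) // andbT.
  rewrite (leq_trans (size_polyD _ _)) // geq_max.
  rewrite (leq_trans (size_scale_leq _ _)) ?size_polyXn //.
  by rewrite (leq_trans (size_scale_leq _ _)) ?size_polyX.
have gi i : g`_i = a *+ (i == 2%N) + b *+ (i == 1%N) + c *+ (i == 0%N).
  rewrite /g !coefD !coefZ coefXn coefX coefC.
  by case: i => [|[|[|i]]]; rewrite /= ?(mulr0, mulr1, mulr0n, mulr1n).
by split; [have := gi 2%N | have := gi 1%N | have := gi 0%N];
  rewrite g0 coef0 /= !(mulr0n, mulr1n, addr0, add0r).
Qed.

Lemma digits_inj (B n : nat) (a b : 'I_n -> nat) :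
  (forall i, a i < B)%N -> (forall i, b i < B)%N ->
  (\sum_(i < n) a i * B ^ i = \sum_(i < n) b i * B ^ i)%N -> a =1 b.
Proof.
elim: n a b => [|n IH] a b aB bB; first by move=> _ [].
have B0 : (0 < B)%N by apply: leq_ltn_trans (aB ord0).
have shift (c : 'I_n.+1 -> nat) : (\sum_(i < n.+1) c i * B ^ i =
    c ord0 + (\sum_(i < n) c (lift ord0 i) * B ^ i) * B)%N.
  rewrite big_ord_recl expn0 muln1; congr addn; rewrite big_distrl.
  by apply: eq_bigr => i _; rewrite /= expnSr mulnA.
rewrite !shift => E.
have E0 : a ord0 = b ord0.
  move/(congr1 (modn^~ B)) : (E); rewrite !(addnC (_ ord0)) !modnMDl.
  by rewrite !modn_small.
move: E; rewrite E0 => /addnI/eqP; rewrite eqn_pmul2r // => /eqP E1.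
have := IH (a \o lift ord0) (b \o lift ord0) (fun i => aB _) (fun i => bB _) E1.
by move=> E2 i; case: (unliftP ord0 i) => [k ->|->] //; apply: E2.
Qed.

(** Kronecker substitution: with [B] above all exponents of [p], the monomials
    of [p] go to distinct powers of one variable under [X_i |-> X^(B^i)]. *)
Lemma mpoly_neq0_nonzero (K : numFieldType) n (p : {mpoly K[n]}) :
  p != 0 -> exists v : 'rV[K]_n, p.@[v 0] != 0.
Proof.
move=> p0; pose B := msize p.
pose h (m : 'X_{1..n}) := (\sum_(i < n) m i * B ^ i)%N.
pose q : {poly K} := \sum_(m <- msupp p) p@_m *: 'X^(h m).
have mB m i : m \in msupp p -> (m i < B)%N.
  move=> /msize_mdeg_lt; apply: leq_ltn_trans.
  by rewrite mdegE (bigD1 i) //= leq_addr.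
have q0 : q != 0.
  have [m0 m0p] : exists m, m \in msupp p.
    exists (mlead p); exact: mlead_supp.
  apply/eqP => /(congr1 (fun r : {poly K} => r`_(h m0))).
  rewrite coef0 coef_sum (bigD1_seq m0) ?msupp_uniq //= coefZ coefXn eqxx mulr1.
  rewrite big_seq_cond big1 ?addr0 => [/eqP|m /andP[mp mm0]]; last first.
    rewrite coefZ coefXn; case: eqP => [E|_]; last by rewrite mulr0.
    case/eqP: mm0; apply/mnmP => i.
    by apply: (digits_inj _ _ (esym E)) => k; apply: mB.
  by move: m0p; rewrite mcoeff_msupp => /negP.
have [x xq] := poly_neq0_nonroot q0.
exists (\row_i x ^+ (B ^ i)); move: xq; congr (_ != 0).
rewrite horner_sum mevalE; apply: eq_bigr => m _.
rewrite hornerZ hornerXn -prodrXr; congr (_ * _).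
by apply: eq_bigr => i _; rewrite mxE -exprM mulnC.
Qed.

Lemma meval_scale (K : fieldType) n d (p : {mpoly K[n]}) (a : K)
    (v : 'rV[K]_n) :
  p \is d.-homog -> p.@[(a *: v) 0] = a ^+ d * p.@[v 0].
Proof.
move=> /dhomogP ph; rewrite !mevalE mulr_sumr; apply: eq_big_seq => m /ph md.
have {}md : mdeg m = d by [].
rewrite mulrCA; congr (_ * _); rewrite -md mdegE -prodrXr -big_split /=.
by apply: eq_bigr => i _; rewrite mxE exprMn.
Qed.

(** * Forms with a fat point, along the lines through it *)

(** The shape that a form of degree [d] acquires when [Q + Y (A + X B)] is
    substituted in it: [X] only occurs in products [X Y], and the coefficient
    [c] of [Y^d] is obtained by dropping [Q]. *)
Definition graded_top (K : fieldType) (d : nat) (p : {poly {poly K}})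
    (c : {poly K}) : Prop :=
  [/\ (size p <= d.+1)%N, forall i, (size (p`_i)%R <= i.+1)%N & p`_d = c].

Lemma graded_topM (K : fieldType) a b (p q : {poly {poly K}}) c e :
  graded_top a p c -> graded_top b q e -> graded_top (a + b) (p * q) (c * e).
Proof.
move=> [sp dp pc] [sq dq qe]; split.
- apply: leq_trans (size_polyMleq _ _) _.
  by move: sp sq; case: (size p) => [|m] /=; case: (size q) => [|k] //=; lia.
- move=> i; rewrite coefM; apply: leq_trans (size_sum _ _ _) _.
  apply/bigmax_leqP => k _; apply: leq_trans (size_polyMleq _ _) _.
  have := dp k; have := dq (i - k)%N; have := ltn_ord k.
  by move: (size p`_k) (size q`_(i - k)) => m l; lia.
- have la : (a < (a + b).+1)%N by lia.
  rewrite coefM (bigD1 (Ordinal la)) //= addKn pc qe big1 ?addr0 // => k ka.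
  have {}ka : (k != a :> nat)%N by [].
  case: (ltngtP k a) ka => // ka _.
    by rewrite [q`_ _]nth_default ?mulr0 //; apply: leq_trans sq _; lia.
  by rewrite [p`_ _]nth_default ?mul0r //; apply: leq_trans sp _; lia.
Qed.

Lemma graded_top1 (K : fieldType) : @graded_top K 0 1 1.
Proof.
split; rewrite ?size_poly1 ?coef1 // => i; rewrite coef1.
by case: i => [|i]; rewrite ?size_poly1 ?size_poly0.
Qed.

Section FatPoint.
Variables (K : numFieldType) (Q A B : 'rV[K]_3).
Implicit Types (f : {mpoly K[3]}) (x y : K).

(** The substitution of the point [Q + Y (A + X B)], which for varying [X] runs
    over the lines joining [Q] to the points of the line [A B]; the outer
    variable is [Y]. *)
Definition pencil : {mpoly K[3]} -> {poly {poly K}} :=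
  mmap (polyC \o polyC) (fun i => (Q 0 i)%:P%:P
    + ((A 0 i)%:P + (B 0 i) *: 'X)%:P * 'X).

Lemma pencilE f x y :
  (pencil f).[y%:P].[x] = f.@[(Q + y *: (A + x *: B)) 0].
Proof.
rewrite /pencil /mmap mevalE !horner_sum; apply: eq_bigr => m _.
rewrite !hornerE /=; congr (_ * _); rewrite /mmap1 !horner_prod.
apply: eq_bigr => i _; rewrite !horner_exp !hornerE !mxE /=.
by congr (_ ^+ _); ring.
Qed.

Lemma pencil_graded_top f d : f \is d.-homog ->
  exists c, graded_top d (pencil f) c /\ forall x, c.[x] = f.@[(A + x *: B) 0].
Proof.
move=> /dhomogP fh.
pose l i : {poly K} := (A 0 i)%:P + (B 0 i) *: 'X.
exists (\sum_(m <- msupp f) (f@_m)%:P * \prod_i l i ^+ m i); split; last first.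
  move=> x; rewrite horner_sum mevalE; apply: eq_bigr => m _.
  rewrite !hornerE horner_prod; congr (_ * _); apply: eq_bigr => i _.
  by rewrite horner_exp !hornerE !mxE; congr (_ ^+ _); ring.
have lin i : graded_top 1 ((Q 0 i)%:P%:P + (l i)%:P * 'X) (l i).
  have sl : (size (l i) <= 2)%N.
    rewrite (leq_trans (size_polyD _ _)) // geq_max.
    rewrite (leq_trans (size_polyC_leq1 _)) //.
    by rewrite (leq_trans (size_scale_leq _ _)) // size_polyX.
  have cl k : ((Q 0 i)%:P%:P + (l i)%:P * 'X)`_k =
      if k == 0%N then (Q 0 i)%:P else if k == 1%N then l i else 0.
    rewrite coefD coefC coefMX coefC; case: k => [|[|k]] //=;
    by rewrite ?addr0 ?add0r.
  split; last by rewrite cl.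
    apply/leq_sizeP => k k2; rewrite cl.
    by case: k k2 => [|[|k]].
  move=> k; rewrite cl; case: k => [|[|k]] //=; rewrite ?size_poly0 //.
  exact: size_polyC_leq1.
have mon m : m \in msupp f -> graded_top d
    ((polyC \o polyC) f@_m * mmap1 (fun i => (Q 0 i)%:P%:P + (l i)%:P * 'X) m)
    ((f@_m)%:P * \prod_i l i ^+ m i).
  move=> mf; rewrite -[d]add0n; apply: graded_topM.
    split; rewrite /= ?coefC ?size_polyC_leq1 // => i; rewrite coefC.
    by case: i => [|i] /=; rewrite ?size_poly0 ?size_polyC_leq1.
  have <- : mdeg m = d by apply: fh.
  rewrite mdegE /mmap1; apply: (big_ind3 (@graded_top K)) => //.
  - exact: graded_top1.
  - by move=> *; apply: graded_topM.
  move=> i _; elim: (m i) => [|k IH]; first exact: graded_top1.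
  by rewrite !exprS -[k.+1]add1n; apply: graded_topM.
rewrite /pencil /mmap.
split.
- apply/leq_sizeP => k kd; rewrite coef_sum big_seq big1 // => m /mon[s _ _].
  by rewrite nth_default // (leq_trans s).
- move=> i; rewrite coef_sum; rewrite big_seq.
  apply: leq_trans (size_sum _ _ _) _.
  by apply/bigmax_leqP_seq => m _ /mon[_ s _].
- rewrite coef_sum; apply: eq_big_seq => m /mon[_ _]; exact.
Qed.

(** The pencil of a polynomial vanishing at [Q] has no constant term in [Y], so
    each factor from the ideal of [Q] contributes a factor [Y]. *)
Lemma pencil_ideal_exp (P : point K) j f : Q \in point_vs P ->
  ideal_exp (ideal_of [set P]) j f ->
  exists q : {poly {poly K}}, pencil f = q * 'X^j.
Proof.
move=> QP; elim: j f => [|j IH] f; first by exists (pencil f); rewrite mulr1.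
rewrite /ideal_exp iterS => -[s sI ->].
have term u : u \in s ->
    exists q : {poly {poly K}}, pencil (u.1 * u.2) = q * 'X^(j.+1).
  move=> /sI[u1 /IH[q Eq]].
  have : root (pencil u.1) 0.
    apply/eqP/polyP => i; have : (pencil u.1).[0] = (u.1.@[Q 0])%:P.
      rewrite /pencil /mmap mevalE !horner_sum rmorph_sum; apply: eq_bigr.
      move=> m _; rewrite !hornerE rmorphM /=; congr (_ * _).
      rewrite /mmap1 horner_prod rmorph_prod; apply: eq_bigr => k _.
      by rewrite horner_exp !hornerE ?mulr0 ?addr0 rmorphXn.
    by move=> ->; rewrite (u1 _ _ _ QP).
  move=> /factor_theorem[q' Eq']; exists (q' * q).
  by rewrite /pencil rmorphM -/pencil /= -/pencil Eq Eq' subr0 exprS; ring.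
elim: s {sI} term => [|u s IHs] term.
  by exists 0; rewrite big_nil mul0r /pencil raddf0.
have [q Eq] := term u (mem_head _ _).
have [q' Eq'] := IHs (fun v vs => term v (@mem_behead _ (u :: s) v vs)).
exists (q + q'); rewrite big_cons mulrDl -Eq -Eq'.
by rewrite /pencil raddfD.
Qed.

(** Only two powers of the outer variable survive: the multiplicity excludes
    those below [j], and the degree those above [j + 1]. *)
Lemma fat_form_on_pencil (P : point K) j f : Q \in point_vs P ->
    f \is j.+1.-homog -> ideal_exp (ideal_of [set P]) j f ->
  [/\ (size ((pencil f)`_j)%R <= j.+1)%N,
      (size ((pencil f)`_(j.+1))%R <= j.+2)%N,
      forall x, ((pencil f)`_(j.+1)).[x] = f.@[(A + x *: B) 0] &
      forall x y, f.@[(Q + y *: (A + x *: B)) 0] =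
        y ^+ j * (((pencil f)`_j).[x] + y * ((pencil f)`_(j.+1)).[x])].
Proof.
move=> QP fh fI; have [c [[s g <-] cE]] := pencil_graded_top fh.
split=> // x y; have [q Eq] := pencil_ideal_exp QP fI.
have Ep : pencil f =
    (((pencil f)`_j)%:P + ((pencil f)`_(j.+1))%:P * 'X) * 'X^j.
  apply/polyP => k; rewrite coefMXn; case: ltnP => [kj|jk].
    by rewrite {1}Eq coefMXn kj.
  have -> : k = (k - j + j)%N by lia.
  move: (k - j)%N => m; rewrite addnK coefD coefC coefMX coefC.
  case: m => [|[|m]]; rewrite ?addr0 ?add0r //=.
  by rewrite nth_default //; apply: leq_trans s _; lia.
by rewrite -pencilE {1}Ep !hornerE /=; ring.
Qed.

End FatPoint.

(** * Counting dimensions *)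

Lemma dimv_le_coords (K : fieldType) (W : vectType K) (U : {vspace W}) n
    (phi : {linear W -> 'rV[K]_n}) :
  (forall f, f \in U -> phi f = 0 -> f = 0) -> (\dim U <= n)%N.
Proof.
move=> inj.
have -> : \dim U = \dim (linfun phi @: U)%VS.
  rewrite limg_dim_eq //; apply/eqP; rewrite -subv0; apply/subvP => f.
  rewrite memv_cap memv_ker lfunE => /andP[fU /eqP/(inj _ fU)->].
  exact: mem0v.
apply: leq_trans (dimvS (subvf _)) _.
by rewrite dimvf /dim /= mul1n.
Qed.

Lemma dimv_ge_conditions (K : fieldType) (W : vectType K) (U : {vspace W}) n
    (phi : {linear W -> 'rV[K]_n}) :
  (forall f, phi f = 0 -> f \in U) -> (\dim {: W} - n <= \dim U)%N.
Proof.
move=> kerU; rewrite leq_subLR.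
have <- := limg_ker_dim (linfun phi) {: W}%VS.
rewrite addnC leq_add //.
  apply: leq_trans (dimvS (subvf _)) _.
  by rewrite dimvf /dim /= mul1n.
apply/dimvS/subvP => f; rewrite memv_cap memv_ker lfunE => /andP[_ /eqP].
exact: kerU.
Qed.

Lemma dim_forms (K : fieldType) d : \dim {: dhomog 3 K d} = 'C(d.+2, 2).
Proof.
rewrite dimvf /dim /= -bin_sub ?leq_addr // addKn addnC; congr 'C(_, _).
Qed.

Section Evaluation.
Variables (K : numFieldType) (d : nat).
Local Notation W := (dhomog 3 K d).

Definition evals n (vs : n.-tuple 'rV[K]_3) (f : W) : 'rV[K]_n :=
  \row_i (f : {mpoly K[3]}).@[tnth vs i 0].

Lemma evals_is_linear n (vs : n.-tuple 'rV[K]_3) : linear (evals vs).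
Proof.
by move=> a f g; apply/rowP => i; rewrite !mxE /= mevalD mevalZ.
Qed.

HB.instance Definition _ n (vs : n.-tuple 'rV[K]_3) :=
  GRing.isLinear.Build K W 'rV[K]_n *:%R (evals vs) (evals_is_linear vs).

Lemma dim_ideal_of_ge (Z : set (point K)) (vs : seq 'rV[K]_3) :
  (forall f : W, (forall v, v \in vs -> (f : {mpoly K[3]}).@[v 0] = 0) ->
     ideal_of Z (f : {mpoly K[3]})) ->
  ('C(d.+2, 2) - size vs <= \dim (degree_part (ideal_of Z) d))%N.
Proof.
move=> ZI; rewrite -(dim_forms K d); pose phi := evals (in_tuple vs).
apply: (dimv_ge_conditions (phi := phi)) => f f0.
apply/(degree_partP _ (subspace_ideal_of Z))/ZI => v /(nthP 0)[i ivs <-].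
have := congr1 (fun r : 'rV_(size vs) => r 0 (Ordinal ivs)) f0.
by rewrite !mxE (tnth_nth 0).
Qed.

(** If each point of the list is missed by a form of degree [d] through the
    points before it, then the points impose independent conditions on forms of
    degree [d]. *)
Lemma dim_ideal_of_le (Z : set (point K)) (vs : seq 'rV[K]_3) :
  (forall v, v \in vs -> exists P, Z P /\ v \in point_vs P) ->
  (forall i, (i < size vs)%N -> exists f : W,
     (forall v, v \in take i vs -> (f : {mpoly K[3]}).@[v 0] = 0) /\
     (f : {mpoly K[3]}).@[(nth 0 vs i) 0] != 0) ->
  (\dim (degree_part (ideal_of Z) d) + size vs <= 'C(d.+2, 2))%N.
Proof.
move=> vsZ wit; rewrite -(dim_forms K d).
have main n : (n <= size vs)%N -> exists U : {vspace W},
    (\dim U + n <= \dim {: W})%N /\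
    forall f : W, (forall v, v \in take n vs -> (f : {mpoly K[3]}).@[v 0] = 0) ->
      f \in U.
  elim: n => [|n IH] nvs.
    by exists fullv; rewrite addn0 leqnn; split=> // f _; rewrite memvf.
  have [U [dU UP]] := IH (ltnW nvs).
  pose phi := evals [tuple of [:: nth 0 vs n]].
  exists (U :&: lker (linfun phi))%VS; split.
    have [f [f0 fn]] := wit n nvs.
    apply: leq_trans dU; rewrite addnS ltn_add2r ltn_neqAle dimvS ?capvSl //.
    rewrite andbT; apply: contraNneq fn => E.
    have /eqP EU : (U :&: lker (linfun phi) == U)%VS.
      by rewrite eqEdim capvSl E /=.
    have : f \in (U :&: lker (linfun phi))%VS by rewrite EU; apply: UP.
    rewrite memv_cap memv_ker lfunE => /andP[_ /eqP/rowP/(_ ord0)].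
    by rewrite !mxE (tnth_nth 0) => ->.
  move=> f f0; rewrite memv_cap memv_ker lfunE UP /=; last first.
    by move=> v vn; apply: f0; rewrite (take_nth 0) // mem_rcons inE vn orbT.
  apply/eqP/rowP => i; rewrite !mxE (tnth_nth 0) ord1 /=.
  by apply: f0; rewrite (take_nth 0) // mem_rcons inE eqxx.
have [U [dU UP]] := main _ (leqnn _).
apply: leq_trans dU; rewrite leq_add2r; apply/dimvS/subvP => f.
move=> /(degree_partP _ (subspace_ideal_of Z)) fZ; apply: UP => v.
by rewrite take_size => /vsZ[P [ZP vP]]; apply: fZ vP.
Qed.

End Evaluation.

(** On the polynomials of bounded degree with prescribed roots, the coefficients
    of index at least the number of roots are therefore injective coordinates:
    this bounds the dimension of that space. *)
Lemma poly_eq0_roots_coefs (K : fieldType) (p : {poly K}) (rs : seq K) n :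
  (size p <= n)%N -> uniq rs -> all (root p) rs ->
  (forall i, (size rs <= i < n)%N -> p`_i = 0) -> p = 0.
Proof.
move=> pn urs prs pc; apply/eqP; apply: contraTT isT => p0.
have := max_poly_roots p0 prs urs; rewrite ltnNge => /negP; case.
apply/leq_sizeP => i ri; case: (ltnP i n) => ni; first by rewrite pc ?ri.
by rewrite nth_default // (leq_trans pn).
Qed.

Section FatBound.
Variables (K : numFieldType) (Q A B : 'rV[K]_3).

Hypothesis span : forall v : 'rV[K]_3, exists a b c,
  v = a *: Q + b *: A + c *: B.

(** The lines joining [Q] to the points [A + x B] sweep out a dense set. *)
Lemma eq0_on_pencil d (f : {mpoly K[3]}) : f \is d.-homog ->
  (forall x y, f.@[(Q + y *: (A + x *: B)) 0] = 0) -> f = 0.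
Proof.
move=> fh f0; apply/eqP; apply: contraT => /mpoly_neq0_nonzero[v fv].
have [a [b [c vE]]] := span v.
(* moving from v towards Q + A leaves the lines where the coordinates on Q and
   A vanish *)
pose g : {poly K} := mmap polyC (fun i => (v 0 i)%:P + ((Q + A) 0 i) *: 'X) f.
have gE x : g.[x] = f.@[(v + x *: (Q + A)) 0].
  rewrite /g /mmap mevalE horner_sum; apply: eq_bigr => m _.
  rewrite hornerM hornerC; congr (_ * _).
  rewrite horner_prod; apply: eq_bigr => i _.
  by rewrite horner_exp !hornerE !mxE; congr (_ ^+ _); ring.
have : g * ('X + a%:P) * ('X + b%:P) != 0.
  rewrite !mulf_neq0 //; try by rewrite -size_poly_eq0 size_XaddC.
  apply: contraNneq fv => g0; have := gE 0.
  by rewrite g0 horner0 scale0r addr0 => <-.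
case/poly_neq0_nonroot => x; rewrite !hornerE gE !mulf_eq0 !negb_or.
case/andP => /andP[fx xa0] xb0; case/eqP: fx.
have -> : v + x *: (Q + A) = (x + a) *: (Q + ((x + b) / (x + a)) *:
    (A + (c / (x + b)) *: B)).
  rewrite vE !scalerDr !scalerA !scalerDl.
  have -> : (x + a) * ((x + b) / (x + a)) = x + b by field.
  have -> : (x + b) * (c / (x + b)) = c by field.
  by rewrite !scalerDl; apply/rowP => i; rewrite !mxE; ring.
by rewrite (meval_scale _ _ fh) f0 mulr0.
Qed.

Variables (P : point K) (j : nat) (QP : Q \in point_vs P).
Local Notation W := (dhomog 3 K j.+1).

(** The coefficients left free when [m] roots are prescribed to the restriction
    to the line [A B], and [n] roots to the other surviving coefficient of the
    pencil. *)
Definition residual_coefs (m n : nat) (f : W) :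
    'rV[K]_((j.+2 - m) + (j.+1 - n)) :=
  row_mx (\row_i ((pencil Q A B f)`_(j.+1))`_(m + i))
         (\row_i ((pencil Q A B f)`_j)`_(n + i)).

Lemma residual_coefs_is_linear m n : linear (residual_coefs m n).
Proof.
move=> a f g; rewrite /residual_coefs scale_row_mx add_row_mx.
have E : pencil Q A B (a *: f + g : W) =
    a%:P%:P * pencil Q A B f + pencil Q A B g.
  by rewrite linearP /pencil raddfD /= mmapZ.
by congr row_mx; apply/rowP => i; rewrite !mxE E !(coefD, coefCM).
Qed.

HB.instance Definition _ m n :=
  GRing.isLinear.Build K W _ *:%R (residual_coefs m n)
    (residual_coefs_is_linear m n).

(** A form of degree [j+1] with multiplicity [j] at [Q] is given by a binary
    form of degree [j+1], its restriction to the line [A B], and, once this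
    vanishes, by a binary form of degree [j] on the pencil of lines through
    [Q].  Points of the line [A B] impose conditions on the first, points on
    distinct lines of the pencil impose conditions on the second. *)
Lemma dim_fat_le (Z : set (point K)) (xs ys : seq K) :
  uniq xs -> uniq ys ->
  (forall x, x \in xs -> exists R, Z R /\ A + x *: B \in point_vs R) ->
  (forall x, x \in ys -> exists2 y, y != 0 &
     exists R, Z R /\ Q + y *: (A + x *: B) \in point_vs R) ->
  (\dim (degree_part (fat_ideal Z j P) j.+1) <=
     (j.+2 - size xs) + (j.+1 - size ys))%N.
Proof.
move=> uxs uys xsZ ysZ.
apply: (dimv_le_coords (phi := residual_coefs (size xs) (size ys))) => f.
move=> /(degree_partP _ (subspace_fat_ideal _ _ _))[fZ fQ].
have fh : (f : {mpoly K[3]}) \is j.+1.-homog by exact: dhomog_is_dhomog.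
have [s1 s2 betaE fE] := fat_form_on_pencil A B QP fh fQ.
move=> rc0; have /eq_row_mx[/rowP c2 /rowP c1] :
    residual_coefs (size xs) (size ys) f = row_mx 0 0 by rewrite row_mx0.
have beta0 : (pencil Q A B f)`_(j.+1) = 0.
  apply: (poly_eq0_roots_coefs s2 uxs).
    by apply/allP => x /xsZ[R [ZR xR]]; apply/rootP; rewrite betaE (fZ _ _ ZR).
  move=> i /andP[xi ij]; have li : (i - size xs < j.+2 - size xs)%N.
    by rewrite ltn_sub2r // (leq_ltn_trans xi).
 
  by have := c2 (Ordinal li); rewrite !mxE /= subnKC.
have alpha0 : (pencil Q A B f)`_j = 0.
  apply: (poly_eq0_roots_coefs s1 uys).
    apply/allP => x /ysZ[y y0 [R [ZR xR]]]; apply/rootP.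
    have := fZ _ _ ZR xR; rewrite fE beta0 horner0 mulr0 addr0 => /eqP.
    by rewrite mulf_eq0 expf_eq0 (negbTE y0) andbF => /eqP.
  move=> i /andP[xi ij]; have li : (i - size ys < j.+1 - size ys)%N.
    by rewrite ltn_sub2r // (leq_ltn_trans xi).
 
  by have := c1 (Ordinal li); rewrite !mxE /= subnKC.
apply/val_inj/(eq0_on_pencil fh) => x y.
by rewrite fE alpha0 beta0 !horner0 mulr0 addr0 mulr0.
Qed.

End FatBound.

(** * General points *)

Section General.
Variable K : numFieldType.
Implicit Types (c v : 'rV[K]_3).

Definition linear_form c : {mpoly K[3]} := \sum_i c 0 i *: 'X_i.

Lemma linear_formE c v : (linear_form c).@[v 0] = \sum_i c 0 i * v 0 i.
Proof.
rewrite /linear_form raddf_sum; apply: eq_bigr => i _ /=.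
by rewrite mevalZ mevalXU.
Qed.

Lemma linear_form_homog c : linear_form c \is 1.-homog.
Proof. by apply: rpred_sum => i _; apply: rpredZ; rewrite dhomogX /= mdeg1. Qed.

Lemma linear_form_neq0 c : c != 0 -> linear_form c != 0.
Proof.
move=> /rV0Pn[i ci]; apply: contraNneq ci => l0.
have := linear_formE c (delta_mx 0 i); rewrite l0 meval0 (bigD1 i) //= big1.
  by rewrite addr0 mxE !eqxx mulr1 => <-.
by move=> k ki; rewrite mxE (negbTE ki) andbF mulr0.
Qed.

Lemma point_of_vector v : v != 0 -> exists P : point K, point_vs P = <[v]>%VS.
Proof.
move=> v0; have dv : \dim <[v]>%VS == 1%N by rewrite dim_vline v0.
by exists (Point dv).
Qed.

Lemma point_vector (P : point K) :
  exists2 v, v != 0 & point_vs P = <[v]>%VS.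
Proof.
case: P => U /= dU; exists (vpick U).
  by rewrite vpick0 -dimv_eq0 (eqP dU).
apply/esym/eqP; rewrite eqEdim -memvE memv_pick (eqP dU) dim_vline.
by rewrite vpick0 -dimv_eq0 (eqP dU).
Qed.

Lemma general_and (T1 T2 : point K -> Prop) :
  general T1 -> general T2 -> general (fun P => T1 P /\ T2 P).
Proof.
move=> [d1 [g1 [g1n T1g]]] [d2 [g2 [g2n T2g]]].
have gh : (g1 : {mpoly K[3]}) * (g2 : {mpoly K[3]}) \is (d1 + d2).-homog.
  by apply: dhomogM; exact: dhomog_is_dhomog.
exists (d1 + d2)%N, (DHomog gh); split.
  move=> /(congr1 val) /= /eqP; rewrite mulf_eq0 => /orP[]/eqP g0.
    by apply/g1n/val_inj.
  by apply/g2n/val_inj.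
move=> P gP; split.
  by apply: T1g => gP1; apply: gP => R v RP vR; rewrite mevalM (gP1 R) ?mul0r.
by apply: T2g => gP1; apply: gP => R v RP vR; rewrite mevalM (gP1 R) ?mulr0.
Qed.

Lemma general_imp (T1 T2 : point K -> Prop) :
  (forall P, T1 P -> T2 P) -> general T1 -> general T2.
Proof. by move=> T12 [d [g [gn Tg]]]; exists d, g; split=> // P /Tg/T12. Qed.

Lemma general_exists (T : point K -> Prop) : general T -> exists P, T P.
Proof.
move=> [d [g [gn Tg]]].
have : (g : {mpoly K[3]}) * 'X_ord0 != 0.
  rewrite mulf_neq0 //; last by rewrite -msupp_eq0 msuppX.
  by apply/eqP => g0; apply/gn/val_inj.
case/mpoly_neq0_nonzero => v; rewrite !mevalM mevalXU !mulf_eq0 !negb_or.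
case/andP => gv v0; have [|P PE] := @point_of_vector v.
  by apply: contraNneq v0 => ->; rewrite mxE.
have vP : v \in point_vs P by rewrite PE memv_line.
by exists P; apply: Tg => /(_ P v erefl vP) /eqP; rewrite (negbTE gv).
Qed.

(** The product of the linear forms is an equation of the curve to avoid. *)
Lemma general_off_lines (cs : seq 'rV[K]_3) (T : point K -> Prop) :
  (forall c, c \in cs -> c != 0) ->
  (forall P v, v \in point_vs P ->
     (forall c, c \in cs -> \sum_i c 0 i * v 0 i != 0) -> T P) ->
  general T.
Proof.
move=> cs0 TP; pose g := \prod_(c <- cs) linear_form c.
have gh : g \is (size cs).-homog.
  rewrite /g; elim: cs {cs0 TP g} => [|c cs IH].
    by rewrite big_nil dhomog1.
  by rewrite big_cons; apply: (dhomogM (linear_form_homog c) IH).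
have g0 : g != 0.
  rewrite /g big_seq; elim/big_rec: _ => [|c h /cs0 c0 h0].
    exact: oner_neq0.
  by rewrite mulf_neq0 // linear_form_neq0.
exists (size cs), (DHomog gh); split=> [/(congr1 val) /= /eqP|P gP].
  by rewrite (negbTE g0).
have [v [vP gv]] : exists v, v \in point_vs P /\ g.@[v 0] != 0.
  apply: contrapT => nv; apply: gP => R v /= -> vP; apply/eqP.
  by apply: contraT => gv; case: nv; exists v.
apply: TP vP _ => c cc; rewrite -linear_formE; apply: contraNneq gv => c0.
by rewrite /g (big_rem _ cc) /= mevalM c0 mul0r.
Qed.

End General.

(** * Row vectors of length three *)

Section Vec3.
Variable K : fieldType.
Implicit Types (v w : 'rV[K]_3).

Lemma vec3_0 (a b c : K) : vec3 a b c 0 0 = a. Proof. by rewrite mxE. Qed.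
Lemma vec3_1 (a b c : K) : vec3 a b c 0 1 = b. Proof. by rewrite mxE. Qed.
Lemma vec3_2 (a b c : K) : vec3 a b c 0 2 = c. Proof. by rewrite mxE. Qed.
Definition vec3E := (vec3_0, vec3_1, vec3_2).

Lemma eq_row3 v w :
  v 0 0 = w 0 0 -> v 0 1 = w 0 1 -> v 0 2 = w 0 2 -> v = w.
Proof.
move=> e0 e1 e2; apply/rowP => -[[|[|[|//]]] i3].
- by rewrite (_ : Ordinal i3 = 0) //; apply/val_inj.
- by rewrite (_ : Ordinal i3 = 1) //; apply/val_inj.
- by rewrite (_ : Ordinal i3 = 2) //; apply/val_inj.
Qed.

Lemma vec3_eta v : vec3 (v 0 0) (v 0 1) (v 0 2) = v.
Proof. by apply: eq_row3; rewrite vec3E. Qed.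

Lemma vec3D (a b c d e f : K) :
  vec3 a b c + vec3 d e f = vec3 (a + d) (b + e) (c + f).
Proof. by apply: eq_row3; rewrite !vec3E mxE !vec3E. Qed.

Lemma vec3Z (k a b c : K) : k *: vec3 a b c = vec3 (k * a) (k * b) (k * c).
Proof. by apply: eq_row3; rewrite !vec3E mxE !vec3E. Qed.

Lemma vec3_eq0 (a b c : K) : vec3 a b c = 0 -> [/\ a = 0, b = 0 & c = 0].
Proof.
move=> E; split; [have := congr1 (fun v => v 0 0) E
  | have := congr1 (fun v => v 0 1) E | have := congr1 (fun v => v 0 2) E];
by rewrite vec3E mxE.
Qed.

Lemma sum3 (F : 'I_3 -> K) : \sum_i F i = F 0 + F 1 + F 2.
Proof.
rewrite !big_ord_recl big_ord0 addr0 addrA; congr (F _ + F _ + F _);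
exact: val_inj.
Qed.

End Vec3.

(** * Polygonal configurations in adapted coordinates *)

Section Configuration.
Variables (K : numFieldType) (N : nat) (T : 'M[K]_3) (rs : seq K).
Hypotheses (T_unit : T \in unitmx) (N_gt2 : (2 < N)%N).
Hypotheses (rs_uniq : uniq rs) (size_rs : size rs = N).
Hypothesis rsP : forall x, (x \in rs) = (x ^+ N == 1).

(** The matrix [T] carries coordinates adapted to the polygon to the coordinates
    of the dual plane.  In the former, the sides are the points [(1 : x : 1/x)]
    of a conic and the axes the points [(0 : 1 : - x)] of a line, where [x] runs
    over the [N]-th roots of unity, and the line at infinity is [(1 : 0 : 0)].
    The line joining the sides [x] and [y] contains the axis [1/(x y)]. *)
Definition in_frame (a b c : K) : 'rV[K]_3 := vec3 a b c *m T.
Definition side_vec (x : K) := in_frame 1 x x^-1.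
Definition axis_vec (x : K) := in_frame 0 1 (- x).
Definition infinity_vec := in_frame 1 0 0.

Definition frame_coords (v : 'rV[K]_3) := v *m invmx T.

Lemma in_frame_coords (v : 'rV[K]_3) :
  in_frame (frame_coords v 0 0) (frame_coords v 0 1) (frame_coords v 0 2) = v.
Proof. by rewrite /in_frame vec3_eta mulmxKV. Qed.

Lemma coords_in_frame a b c : frame_coords (in_frame a b c) = vec3 a b c.
Proof. by rewrite /frame_coords mulmxK. Qed.

Lemma in_frameD a b c d e f :
  in_frame a b c + in_frame d e f = in_frame (a + d) (b + e) (c + f).
Proof. by rewrite /in_frame -mulmxDl vec3D. Qed.

Lemma in_frameZ k a b c :
  k *: in_frame a b c = in_frame (k * a) (k * b) (k * c).
Proof. by rewrite /in_frame scalemxAl vec3Z. Qed.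

Lemma in_frame_neq0 a b c :
  [|| a != 0, b != 0 | c != 0] -> in_frame a b c != 0.
Proof.
apply: contraTneq => E; have := coords_in_frame a b c; rewrite E.
by rewrite /frame_coords mul0mx => /esym/vec3_eq0[-> -> ->]; rewrite eqxx.
Qed.

Lemma root_neq0 x : x \in rs -> x != 0.
Proof.
rewrite rsP; apply: contraTneq => ->; rewrite expr0n.
by case: N N_gt2 => //= n _; rewrite eq_sym oner_eq0.
Qed.

Definition coord_form (a b c : K) : {mpoly K[3]} :=
  linear_form (vec3 a b c *m (invmx T)^T).

Lemma coord_formE a b c (v : 'rV[K]_3) : (coord_form a b c).@[v 0] =
  a * frame_coords v 0 0 + b * frame_coords v 0 1 + c * frame_coords v 0 2.
Proof.
rewrite linear_formE.
have -> : \sum_i (vec3 a b c *m (invmx T)^T) 0 i * v 0 i =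
    (vec3 a b c *m (frame_coords v)^T) 0 0.
  rewrite /frame_coords trmx_mul mulmxA mxE.
  by apply: eq_bigr => i _; rewrite [v^T _ _]mxE.
by rewrite mxE sum3 ![(frame_coords v)^T _ _]mxE !vec3E.
Qed.

Lemma coord_formE_frame a b c d e f :
  (coord_form a b c).@[(in_frame d e f) 0] = a * d + b * e + c * f.
Proof. by rewrite coord_formE coords_in_frame !vec3E. Qed.

Lemma coord_form_homog a b c : coord_form a b c \is 1.-homog.
Proof. exact: linear_form_homog. Qed.

(** In the affine chart where the first coordinate is one: the line at infinity,
    the lines of direction [(0 : 0 : 1)] through the points, and the lines
    joining two points.  From a centre outside these lines, the points project
    injectively to the line at infinity, and not to [(0 : 0 : 1)]. *)
Definition bad_lines (pts : seq (K * K)) : seq 'rV[K]_3 :=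
  vec3 1 0 0 :: [seq vec3 p.1 (- 1) 0 | p <- pts] ++
  [seq if p == q then vec3 1 0 0 else
    vec3 (p.2 * q.1 - q.2 * p.1) (q.2 - p.2) (p.1 - q.1) | p <- pts, q <- pts].

Lemma bad_lines_neq0 pts c : c \in bad_lines pts -> c != 0.
Proof.
rewrite inE mem_cat => /orP[/eqP->|/orP[/mapP[p _ ->]|]].
- by apply/eqP => /vec3_eq0[/eqP]; rewrite oner_eq0.
- by apply/eqP => /vec3_eq0[_ /eqP]; rewrite oppr_eq0 oner_eq0.
case/allpairsP => -[[p1 p2] [q1 q2]] [_ _ ->] /=; case: ifP => [_|/negbT/eqP pq].
  by apply/eqP => /vec3_eq0[/eqP]; rewrite oner_eq0.
apply/eqP => /vec3_eq0[_ /eqP q2E /eqP q1E]; apply: pq.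
by move: q2E q1E; rewrite !subr_eq0 => /eqP-> /eqP->.
Qed.

(** The axes lie on the line through [(0 : 1 : 0)] and [(0 : 0 : 1)], and the
    slopes seen from a general [Q] distinguish the points off this line, so that
    all of them impose as many conditions as possible in [dim_fat_le]. *)
Lemma general_dim_fat_le (Z : set (point K)) (pts : seq (K * K)) :
  uniq pts ->
  (forall x, x \in rs -> exists R, Z R /\ axis_vec x \in point_vs R) ->
  (forall p, p \in pts -> exists R, Z R /\ in_frame 1 p.1 p.2 \in point_vs R) ->
  general (fun P => forall j,
    (\dim (degree_part (fat_ideal Z j P) j.+1) <=
     (j.+2 - N) + (j.+1 - size pts))%N).
Proof.
move=> upts axZ ptsZ.
apply: (@general_off_lines _ [seq c *m (invmx T)^T | c <- bad_lines pts]).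
  move=> _ /mapP[c /bad_lines_neq0 c0 ->]; apply: contraNneq c0 => E.
  have uT : (invmx T)^T \in unitmx by rewrite unitmx_tr unitmx_inv.
  by rewrite -[c](mulmxK uT) E mul0mx.
move=> P v vP off j.
have {}off a b c : vec3 a b c \in bad_lines pts ->
    a * frame_coords v 0 0 + b * frame_coords v 0 1 + c * frame_coords v 0 2
      != 0.
  move=> bad; rewrite -coord_formE linear_formE; apply: off.
  by apply/mapP; exists (vec3 a b c).
have q0 : frame_coords v 0 0 != 0.
  by have := off 1 0 0; rewrite mul1r !mul0r !addr0; apply; rewrite inE eqxx.
pose a := frame_coords v 0 1 / frame_coords v 0 0.
pose b := frame_coords v 0 2 / frame_coords v 0 0.
have Qv : (frame_coords v 0 0)^-1 *: v = in_frame 1 a b.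
  rewrite -{2}[v]in_frame_coords in_frameZ.
  by rewrite mulVf // mulrC [_^-1 * _]mulrC.
have QP : in_frame 1 a b \in point_vs P by rewrite -Qv memvZ.
have pa p : p \in pts -> p.1 - a != 0.
  move=> pp; have := off p.1 (-1) 0.
  rewrite mul0r addr0 mulN1r => H.
  have : p.1 * frame_coords v 0 0 - frame_coords v 0 1 != 0.
    by apply: H; rewrite inE mem_cat (map_f _ pp) orbT.
  apply: contraNneq => E; apply/eqP.
  by move/(congr1 ( *%R^~ (frame_coords v 0 0))): E;
     rewrite mul0r mulrBl divfK.
pose slope (p : K * K) := (p.2 - b) / (p.1 - a).
have uys : uniq (map slope pts).
  rewrite map_inj_in_uniq // => p q pp qp /eqP.
  rewrite eqr_div ?pa // => /eqP E; apply/eqP; apply: contraT => pq.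
  have := off (p.2 * q.1 - q.2 * p.1) (q.2 - p.2) (p.1 - q.1).
  rewrite inE mem_cat => H; suff: false by [].
  rewrite -(negbTE (H _)); last first.
    apply/orP; right; apply/orP; right; apply/allpairsP.
    by exists (p, q); rewrite /= (negbTE pq).
  have -> : frame_coords v 0 1 = a * frame_coords v 0 0 by rewrite divfK.
  have -> : frame_coords v 0 2 = b * frame_coords v 0 0 by rewrite divfK.
  apply/eqP; have {}E : (p.2 - b) * (q.1 - a) - (q.2 - b) * (p.1 - a) = 0.
    by rewrite E subrr.
  transitivity (((p.2 - b) * (q.1 - a) - (q.2 - b) * (p.1 - a)) *
    frame_coords v 0 0); last by rewrite E mul0r.
  by ring.
rewrite -size_rs -(size_map (@GRing.opp K) rs) -(size_map slope pts).
apply: (@dim_fat_le _ (in_frame 1 a b) (in_frame 0 1 0) (in_frame 0 0 1)) => //.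
- move=> w; exists (frame_coords w 0 0),
    (frame_coords w 0 1 - a * frame_coords w 0 0),
    (frame_coords w 0 2 - b * frame_coords w 0 0).
  rewrite !in_frameZ !in_frameD -[LHS]in_frame_coords.
  by congr in_frame; ring.
- by rewrite map_inj_uniq //; apply: oppr_inj.
- move=> _ /mapP[x xrs ->].
  have -> : in_frame 0 1 0 + - x *: in_frame 0 0 1 = axis_vec x.
    by rewrite in_frameZ in_frameD /axis_vec; congr in_frame; ring.
  exact: axZ.
- move=> _ /mapP[p pp ->]; exists (p.1 - a); first exact: pa.
  rewrite !(in_frameZ, in_frameD) -/(slope p).
  have -> : 1 + (p.1 - a) * (0 + slope p * 0) = 1 by ring.
  have -> : a + (p.1 - a) * (1 + slope p * 0) = p.1 by ring.
  have -> : b + (p.1 - a) * (0 + slope p * 1) = p.2.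
    by rewrite /slope; field; apply: pa.
  exact: ptsZ.
Qed.

Definition polygonal_point (P : point K) : Prop := exists2 x, x \in rs &
  point_vs P = <[side_vec x]>%VS \/ point_vs P = <[axis_vec x]>%VS.

Definition polygonal_points (Z : set (point K)) : Prop :=
  forall P, Z P <-> polygonal_point P.

Definition complete_polygonal_points (Z : set (point K)) : Prop :=
  forall P, Z P <-> polygonal_point P \/ point_vs P = <[infinity_vec]>%VS.

Lemma side_vec_neq0 x : side_vec x != 0.
Proof. by rewrite in_frame_neq0 // oner_eq0. Qed.

Lemma axis_vec_neq0 x : axis_vec x != 0.
Proof. by rewrite in_frame_neq0 // oner_eq0 orbT. Qed.

Lemma infinity_vec_neq0 : infinity_vec != 0.
Proof. by rewrite in_frame_neq0 // oner_eq0. Qed.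

Lemma side_vec_point (Z : set (point K)) x :
  (forall P, polygonal_point P -> Z P) -> x \in rs ->
  exists R, Z R /\ side_vec x \in point_vs R.
Proof.
move=> ZP xrs; have [R RE] := point_of_vector (side_vec_neq0 x).
exists R; split; last by rewrite RE memv_line.
by apply: ZP; exists x => //; left.
Qed.

Lemma axis_vec_point (Z : set (point K)) x :
  (forall P, polygonal_point P -> Z P) -> x \in rs ->
  exists R, Z R /\ axis_vec x \in point_vs R.
Proof.
move=> ZP xrs; have [R RE] := point_of_vector (axis_vec_neq0 x).
exists R; split; last by rewrite RE memv_line.
by apply: ZP; exists x => //; right.
Qed.

Lemma ideal_of_generators d (f : dhomog 3 K d) (Z : set (point K))
    (vs : seq 'rV[K]_3) :
  (forall P, Z P -> exists2 v, v \in vs & point_vs P = <[v]>%VS) ->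
  (forall v, v \in vs -> (f : {mpoly K[3]}).@[v 0] = 0) ->
  ideal_of Z (f : {mpoly K[3]}).
Proof.
move=> Zvs f0 P w /Zvs[v vvs ->] /vlineP[k ->].
have fh : (f : {mpoly K[3]}) \is d.-homog by exact: dhomog_is_dhomog.
by rewrite (meval_scale _ _ fh) f0 ?mulr0.
Qed.

Definition polygonal_vecs := map axis_vec rs ++ map side_vec rs.

Lemma polygonal_vecsP (Z : set (point K)) P : polygonal_points Z -> Z P ->
  exists2 v, v \in polygonal_vecs & point_vs P = <[v]>%VS.
Proof.
move=> ZP /ZP[x xrs [PE|PE]].
  by exists (side_vec x); rewrite // mem_cat map_f ?orbT.
by exists (axis_vec x); rewrite // mem_cat map_f.
Qed.

Lemma complete_vecsP (Z : set (point K)) P : complete_polygonal_points Z ->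
  Z P -> exists2 v, v \in rcons polygonal_vecs infinity_vec &
    point_vs P = <[v]>%VS.
Proof.
move=> ZP /ZP[[x xrs [PE|PE]]|PE].
- by exists (side_vec x); rewrite // mem_rcons inE mem_cat !map_f ?orbT.
- by exists (axis_vec x); rewrite // mem_rcons inE mem_cat map_f ?orbT.
- by exists infinity_vec; rewrite // mem_rcons inE eqxx.
Qed.

Lemma size_polygonal_vecs : size polygonal_vecs = (N + N)%N.
Proof. by rewrite size_cat !size_map size_rs. Qed.

Lemma bin_step j : ('C(j.+3, 2) = 'C(j.+1, 2) + (j.+1 + j.+2))%N.
Proof. by rewrite [LHS]binS [X in (X + _)%N]binS !bin1; lia. Qed.

Lemma general_dim_fat_polygonal (Z : set (point K)) : polygonal_points Z ->
  general (fun P => forall j,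
    (\dim (degree_part (fat_ideal Z j P) j.+1) <= (j.+2 - N) + (j.+1 - N))%N).
Proof.
move=> ZP; pose pts := [seq (x, x^-1) | x <- rs].
have -> : N = size pts :> nat by rewrite size_map.
rewrite {1}size_map size_rs.
apply: general_dim_fat_le.
- by rewrite map_inj_uniq // => x y [].
- by move=> x; apply: axis_vec_point => P /ZP.
- by move=> _ /mapP[x xrs ->]; apply: side_vec_point xrs => P /ZP.
Qed.

Lemma general_dim_fat_complete (Z : set (point K)) :
  complete_polygonal_points Z ->
  general (fun P => forall j,
    (\dim (degree_part (fat_ideal Z j P) j.+1) <=
     (j.+2 - N) + (j.+1 - N.+1))%N).
Proof.
move=> ZP; pose pts := (0, 0) :: [seq (x, x^-1) | x <- rs].
have -> : N.+1 = size pts :> nat by rewrite /= size_map size_rs.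
apply: general_dim_fat_le.
- rewrite /= map_inj_uniq => [|x y []//]; rewrite rs_uniq andbT.
  by apply/negP => /mapP[x /root_neq0 x0 [/esym/eqP]]; rewrite (negbTE x0).
- by move=> x; apply: axis_vec_point => P PE; apply/ZP; left.
- move=> p; rewrite inE => /orP[/eqP->|/mapP[x xrs ->]] /=.
    have [R RE] := point_of_vector infinity_vec_neq0.
    by exists R; rewrite RE memv_line; split=> //; apply/ZP; right.
  by apply: side_vec_point xrs => P PE; apply/ZP; left.
Qed.

(** The points do not impose more conditions than their number, and the
    [2 N] points of [Z] already impose at least the minimum of [2 N] and
    [2 j + 3] conditions on the curves of degree [j + 1] with a general
    [j]-fold point. *)
Lemma polygonal_not_unexpected (Z : set (point K)) j : polygonal_points Z ->
  ~ unexpected Z j.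
Proof.
move=> ZP unex.
have [P [Pgt /(_ j) Ple]] :=
  general_exists (general_and unex (general_dim_fat_polygonal ZP)).
have := @dim_ideal_of_ge K j.+1 Z polygonal_vecs
  (fun f f0 => ideal_of_generators (fun P => polygonal_vecsP ZP) f0).
move: Pgt Ple; rewrite size_polygonal_vecs bin_step.
move: (\dim _) (\dim _) 'C(j.+1, 2) => m n b; lia.
Qed.

(** There are now [N + 1] points off the line of the axes, and their conditions
    on binary forms of degree [j] become dependent for [j < N], while the
    binary forms of degree [j + 1] with [N] roots vanish for [j + 1 < N].  Hence
    the dimension can exceed the expected one for [j + 1 = N] only. *)
Lemma complete_unexpected_degree (Z : set (point K)) j :
  complete_polygonal_points Z -> unexpected Z j -> j.+1 = N.
Proof.
move=> ZP unex.
have [P [Pgt /(_ j) Ple]] :=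
  general_exists (general_and unex (general_dim_fat_complete ZP)).
have := @dim_ideal_of_ge K j.+1 Z (rcons polygonal_vecs infinity_vec)
  (fun f f0 => ideal_of_generators (fun P => complete_vecsP ZP) f0).
move: Pgt Ple; rewrite size_rcons size_polygonal_vecs bin_step.
move: (\dim _) (\dim _) 'C(j.+1, 2) => m n b; lia.
Qed.

Lemma coord_prod_homog (a b c : K -> K) (s : seq K) :
  \prod_(x <- s) coord_form (a x) (b x) (c x) \is (size s).-homog.
Proof.
elim: s => [|x s IH]; first by rewrite big_nil dhomog1.
by rewrite big_cons; apply: (dhomogM (coord_form_homog _ _ _) IH).
Qed.

Lemma coord_exp_homog a b c n : coord_form a b c ^+ n \is n.-homog.
Proof. by rewrite -{2}[n]mul1n; apply/dhomogMn/coord_form_homog. Qed.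

Lemma nth_notin_take k x : (k < N)%N -> x \in take k rs -> nth 0 rs k != x.
Proof.
move=> kN; apply: contraTneq => <-; move: rs_uniq.
rewrite -{1}(cat_take_drop k rs) (drop_nth 0) ?size_rs // cat_uniq.
by case/and3P => _ /hasPn/(_ (nth 0 rs k)) + _; apply; rewrite inE eqxx.
Qed.

(** Lines through [(1 : 0 : 0)] separate the axes. *)
Lemma axis_separating_form k : (k < N)%N -> exists f : dhomog 3 K N,
  (forall x, x \in take k rs -> (f : {mpoly K[3]}).@[(axis_vec x) 0] = 0) /\
  (f : {mpoly K[3]}).@[(axis_vec (nth 0 rs k)) 0] != 0.
Proof.
move=> kN.
have fh : (\prod_(y <- take k rs) coord_form 0 y 1) *
    coord_form 0 1 0 ^+ (N - k) \is N.-homog.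
  have {2}-> : N = (size (take k rs) + (N - k))%N.
    by rewrite size_takel ?size_rs ?subnKC // ltnW.
  by apply: dhomogM (coord_prod_homog _ _ _ _) (coord_exp_homog _ _ _ _).
exists (DHomog fh); split=> [x xk|]; rewrite /= mevalM rmorph_prod rmorphXn /=.
  rewrite (big_rem x) //= coord_formE_frame.
  by rewrite (_ : _ + _ = 0) ?mul0r //; ring.
rewrite coord_formE_frame mulf_neq0 //; last first.
  by rewrite !mul0r mul1r add0r addr0 expr1n oner_neq0.
rewrite prodf_seq_neq0; apply/allP => x xk; apply/implyP => _.
rewrite coord_formE_frame (_ : _ + _ = x - nth 0 rs k); last by ring.
by rewrite subr_eq0 eq_sym nth_notin_take.
Qed.

(** Lines through [(0 : 0 : 1)] separate the sides, and the line of the axes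
    takes care of the axes. *)
Lemma side_separating_form k : (k < N)%N -> exists f : dhomog 3 K N,
  [/\ forall x, (f : {mpoly K[3]}).@[(axis_vec x) 0] = 0,
      forall x, x \in take k rs -> (f : {mpoly K[3]}).@[(side_vec x) 0] = 0 &
      (f : {mpoly K[3]}).@[(side_vec (nth 0 rs k)) 0] != 0].
Proof.
move=> kN.
have fh : (\prod_(y <- take k rs) coord_form (- y) 1 0) *
    coord_form 1 0 0 ^+ (N - k) \is N.-homog.
  have {2}-> : N = (size (take k rs) + (N - k))%N.
    by rewrite size_takel ?size_rs ?subnKC // ltnW.
  by apply: dhomogM (coord_prod_homog _ _ _ _) (coord_exp_homog _ _ _ _).
have Nk : (N - k)%N != 0%N by rewrite subn_eq0 -ltnNge.
exists (DHomog fh); split=> [x|x xk|];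
    rewrite /= mevalM rmorph_prod rmorphXn /=.
- rewrite coord_formE_frame !mul0r mul1r !addr0 expr0n (negbTE Nk).
  by rewrite mulr0.
- rewrite (big_rem x) //= coord_formE_frame.
  by rewrite (_ : _ + _ = 0) ?mul0r //; ring.
rewrite coord_formE_frame mulf_neq0 //; last first.
  by rewrite !mul0r mul1r !addr0 expr1n oner_neq0.
rewrite prodf_seq_neq0; apply/allP => x xk; apply/implyP => _.
rewrite coord_formE_frame (_ : _ + _ = nth 0 rs k - x); last by ring.
by rewrite subr_eq0 nth_notin_take.
Qed.

(** The conic through the sides avoids [(1 : 0 : 0)]. *)
Lemma infinity_separating_form : exists f : dhomog 3 K N,
  [/\ forall x, (f : {mpoly K[3]}).@[(axis_vec x) 0] = 0,
      forall x, x \in rs -> (f : {mpoly K[3]}).@[(side_vec x) 0] = 0 &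
      (f : {mpoly K[3]}).@[infinity_vec 0] != 0].
Proof.
have fh : (coord_form 0 1 0 * coord_form 0 0 1 - coord_form 1 0 0 ^+ 2) *
    coord_form 1 0 0 ^+ (N - 2) \is N.-homog.
  have {2}-> : N = (2 + (N - 2))%N by rewrite subnKC // ltnW.
  apply: dhomogM (coord_exp_homog _ _ _ _); apply: rpredB.
    exact: (dhomogM (coord_form_homog _ _ _) (coord_form_homog _ _ _)).
  exact: coord_exp_homog.
have N2 : (N - 2)%N != 0%N by rewrite subn_eq0 -ltnNge.
exists (DHomog fh); split=> [x|x /root_neq0 x0|];
    rewrite /= mevalM mevalB mevalM !rmorphXn /= !coord_formE_frame.
- by rewrite !mul0r !mulr0 !addr0 !expr0n (negbTE N2) mulr0.
- by rewrite (_ : _ - _ = 0) ?mul0r //; field.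
- by rewrite !(mul0r, mul1r, mulr0, mulr1, addr0) !expr1n sub0r mulr1 oppr_eq0
     oner_eq0.
Qed.

(** The [2 N + 1] points impose independent conditions in degree [N], as is seen
    by taking the axes first, then the sides, then the line at infinity. *)
Lemma complete_conditions_independent (Z : set (point K)) :
  complete_polygonal_points Z ->
  (\dim (degree_part (ideal_of Z) N) <= 'C(N, 2))%N.
Proof.
move=> ZP; pose vs := rcons polygonal_vecs infinity_vec.
suff H : (\dim (degree_part (ideal_of Z) N) + size vs <= 'C(N.+2, 2))%N.
  move: H; rewrite size_rcons size_polygonal_vecs.
  case: N N_gt2 => // n _; rewrite bin_step.
  by move: (\dim _) 'C(n.+1, 2) => m b; lia.
apply: dim_ideal_of_le.
  move=> v; rewrite mem_rcons inE mem_cat => /orP[/eqP->|/orP[]/mapP[x xrs ->]].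
  - have [R RE] := point_of_vector infinity_vec_neq0.
    by exists R; rewrite RE memv_line; split=> //; apply/ZP; right.
  - by apply: axis_vec_point xrs => P PE; apply/ZP; left.
  - by apply: side_vec_point xrs => P PE; apply/ZP; left.
have sA : size (map axis_vec rs) = N by rewrite size_map.
have sS : size (map side_vec rs) = N by rewrite size_map.
move=> i; rewrite size_rcons ltnS size_polygonal_vecs => iN.
rewrite /vs -cats1 /polygonal_vecs -catA take_cat nth_cat sA.
case: ltnP => [iltN|Ni].
  have [f [f0 fi]] := axis_separating_form iltN; exists f; split.
    by rewrite -map_take => _ /mapP[x xi ->]; apply: f0.
  by rewrite (nth_map 0) ?size_rs.
rewrite take_cat nth_cat sS; case: ltnP => [iltN|Ni2].
  have [f [f0 f1 fi]] := side_separating_form iltN; exists f; split.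
    move=> v; rewrite mem_cat -map_take => /orP[]/mapP[x xi ->]; first exact: f0.
    exact: f1.
  by rewrite (nth_map 0) ?size_rs.
have -> : (i - N - N)%N = 0%N by lia.
have [f [f0 f1 fi]] := infinity_separating_form; exists f; split=> // v.
rewrite take0 cats0 mem_cat => /orP[]/mapP[x xi ->]; first exact: f0.
exact: f1.
Qed.
End Configuration.

(** * The unexpected curve *)

(** The Dickson polynomial: the power sum [x^n + y^n] as a polynomial in
    [a = x + y] and [b = x y]. *)
Fixpoint dickson (A : comNzRingType) (a b : A) (n : nat) : A :=
  if n is n1.+1 then
    if n1 is n2.+1 then a * dickson a b n1 - b * dickson a b n2 else a
  else 2.

Lemma dickson_step (A : comNzRingType) (a b : A) n :
  dickson a b n.+2 = a * dickson a b n.+1 - b * dickson a b n.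
Proof. by []. Qed.

Lemma two_step_ind (P : nat -> Prop) : P 0%N -> P 1%N ->
  (forall n, P n -> P n.+1 -> P n.+2) -> forall n, P n.
Proof.
move=> P0 P1 PS n; suff [] : P n /\ P n.+1 by [].
by elim: n => [|n [Pn Pn1]]; split=> //; apply: PS.
Qed.

Lemma dickson_power_sum (A : comNzRingType) (x y : A) n :
  dickson (x + y) (x * y) n = x ^+ n + y ^+ n.
Proof.
elim/two_step_ind: n => [||n IH IH1]; first by rewrite !expr0 /= -mulr2n.
  by rewrite !expr1.
by rewrite dickson_step IH IH1 !exprS; ring.
Qed.

Lemma dickson_odd0 (A : comNzRingType) (b : A) n : odd n -> dickson 0 b n = 0.
Proof.
elim/two_step_ind: n => [//|//|n IH _]; rewrite /= negbK => /IH En.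
by rewrite -/(dickson 0 b n) En !(mul0r, mulr0) subr0.
Qed.

Lemma rmorph_dickson (A A' : comNzRingType) (f : {rmorphism A -> A'}) a b n :
  f (dickson a b n) = dickson (f a) (f b) n.
Proof.
elim/two_step_ind: n => [||n IH IH1]; rewrite ?rmorph_nat //.
by rewrite !dickson_step rmorphB !rmorphM IH IH1.
Qed.

Section Ideals.
Variables (K : numFieldType) (Z : set (point K)).
Local Notation I := (ideal_of Z).

Lemma ideal_expM p q j : I p -> ideal_exp I j q -> ideal_exp I j.+1 (p * q).
Proof.
move=> Ip Iq; rewrite /ideal_exp iterS; exists [:: (p, q)].
  by move=> u; rewrite inE => /eqP->.
by rewrite big_seq1.
Qed.

Lemma ideal_expXn p j : I p -> ideal_exp I j (p ^+ j).
Proof. by move=> Ip; elim: j => // j IH; rewrite exprS; apply: ideal_expM. Qed.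

Lemma ideal_expD p q j :
  ideal_exp I j p -> ideal_exp I j q -> ideal_exp I j (p + q).
Proof.
move=> Ip Iq; have [_ lin] := subspace_ideal_exp Z j.
by rewrite -[p]scale1r; apply: lin.
Qed.

Lemma ideal_expN p j : ideal_exp I j p -> ideal_exp I j (- p).
Proof.
move=> Ip; have [I0 lin] := subspace_ideal_exp Z j.
by rewrite -[- p]addr0 -scaleN1r; apply: lin.
Qed.

Lemma ideal_exp_mull r p j : ideal_exp I j p -> ideal_exp I j (r * p).
Proof.
case: j => // j; rewrite /ideal_exp iterS => -[s sI ->].
exists [seq (r * u.1, u.2) | u <- s].
  move=> _ /mapP[u /sI[u1 u2] ->]; split=> //= P v ZP vP.
  by rewrite mevalM (u1 _ _ ZP vP) mulr0.
by rewrite big_map mulr_sumr; apply: eq_bigr => u _; rewrite mulrA.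
Qed.

(** [dickson a b n] is a form of degree [n] when [a] and [b] have the weights 1
    and 2. *)
Lemma dickson_ideal_exp p q r n : I p -> I q -> I r ->
  ideal_exp I n (dickson p (q * r) n).
Proof.
move=> Ip Iq Ir; elim/two_step_ind: n => [//||n IH IH1].
  by rewrite -[dickson _ _ _]mulr1; apply: ideal_expM.
rewrite dickson_step -mulrA; apply: ideal_expD; first exact: ideal_expM.
by apply/ideal_expN/ideal_expM => //; apply: ideal_expM.
Qed.

Lemma dickson_homog (p q : {mpoly K[3]}) n : p \is 1.-homog -> q \is 2.-homog ->
  dickson p q n \is n.-homog.
Proof.
move=> ph qh; elim/two_step_ind: n => [||n IH IH1] //.
  by rewrite /= -mpolyC_nat -alg_mpolyC; apply/rpredZ/dhomog1.
rewrite dickson_step; apply: rpredB.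
  exact: (dhomogM ph IH1).
exact: (dhomogM qh IH).
Qed.

End Ideals.

Section UnexpectedCurve.
Variables (K : numFieldType) (N : nat) (T : 'M[K]_3) (rs : seq K).
Hypotheses (T_unit : T \in unitmx) (N_gt2 : (2 < N)%N).
Hypotheses (rs_uniq : uniq rs) (size_rs : size rs = N).
Hypothesis rsP : forall x, (x \in rs) = (x ^+ N == 1).
Hypothesis N_even : ~~ odd N.

Local Notation coord_form := (coord_form T).
Local Notation coords := (frame_coords T).

Variables (P : point K) (v : 'rV[K]_3).
Hypotheses (PE : point_vs P = <[v]>%VS) (v0 : coords v 0 0 != 0).

Let q0 := coords v 0 0.
Let q1 := coords v 0 1.
Let q2 := coords v 0 2.
(* the coordinates of the cross product of the variable point with v *)
Let Z := coord_form 0 q2 (- q1).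
Let U := coord_form (- q2) 0 q0.
Let V := coord_form q1 (- q0) 0.

(** This has degree one in the variable point and degree [N - 1] in its cross
    product [(Z, U, V)] with [v], whence the multiplicity [N - 1] at [P].  The
    first two terms and the Dickson polynomial, which is homogeneous of degree
    [N - 1] for the weights in question, cancel on the sides. *)
Definition unexpected_form : {mpoly K[3]} :=
  coord_form 0 1 0 * V ^+ N.-1 + coord_form 0 0 1 * U ^+ N.-1
  + coord_form 1 0 0 * dickson Z (U * V) N.-1.

Lemma cross_ideal : [/\ ideal_of [set P] Z, ideal_of [set P] U &
  ideal_of [set P] V].
Proof.
have scale k i : coords (k *: v) 0 i = k * coords v 0 i.
  by rewrite /frame_coords -scalemxAl mxE.
by split=> R w -> ; rewrite PE => /vlineP[k ->];
  rewrite coord_formE !scale -/q0 -/q1 -/q2; ring.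
Qed.

Lemma unexpected_form_fat : ideal_exp (ideal_of [set P]) N.-1 unexpected_form.
Proof.
have [IZ IU IV] := cross_ideal.
apply: ideal_expD; first apply: ideal_expD.
- exact/ideal_exp_mull/ideal_expXn.
- exact/ideal_exp_mull/ideal_expXn.
- exact/ideal_exp_mull/dickson_ideal_exp.
Qed.

Lemma unexpected_form_homog : unexpected_form \is N.-homog.
Proof.
have {1}-> : N = (1 + N.-1)%N by rewrite add1n prednK // ltnW // ltnW.
apply: rpredD; first apply: rpredD.
- exact: (dhomogM (coord_form_homog _ _ _ _) (coord_exp_homog _ _ _ _ _)).
- exact: (dhomogM (coord_form_homog _ _ _ _) (coord_exp_homog _ _ _ _ _)).
apply: (dhomogM (coord_form_homog _ _ _ _)); apply: dickson_homog.
  exact: coord_form_homog.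
exact: (dhomogM (coord_form_homog _ _ _ _) (coord_form_homog _ _ _ _)).
Qed.

Lemma unexpected_formE a b c :
  let z := q2 * b - q1 * c in let u := q0 * c - q2 * a in
  let w := q1 * a - q0 * b in
  unexpected_form.@[(in_frame T a b c) 0] =
  b * w ^+ N.-1 + c * u ^+ N.-1 + a * dickson z (u * w) N.-1.
Proof.
rewrite /= /unexpected_form !(mevalD, mevalM) !rmorphXn /= rmorph_dickson.
rewrite /= mevalM !coord_formE_frame //.
by congr (_ * _ ^+ _ + _ * _ ^+ _ + _ * dickson _ (_ * _) _); ring.
Qed.

Lemma odd_predN : odd N.-1.
Proof. by case: N N_gt2 N_even => //= n _; rewrite negbK. Qed.

Lemma unexpected_form_neq0 : unexpected_form != 0.
Proof.
suff : unexpected_form.@[(in_frame T 0 0 1) 0] != 0.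
  by apply: contraNneq => ->; rewrite meval0.
rewrite unexpected_formE !(mul0r, mulr0, mulr1, mul1r, subr0, addr0, add0r).
exact: expf_neq0.
Qed.

(** Here [Z] vanishes, and a Dickson polynomial of odd index is odd in its first
    argument: this is where the parity of [N] matters. *)
Lemma unexpected_form_infinity : unexpected_form.@[(infinity_vec T) 0] = 0.
Proof.
rewrite unexpected_formE !mulr0 !mul0r subr0 dickson_odd0 ?odd_predN //.
by rewrite mulr0 !addr0.
Qed.

(** On a side, [z = - (x u + w / x)], so that Dickson's identity turns the last
    term into [- (x u)^(N-1) - (w / x)^(N-1)]; as [x^N = 1], this cancels the
    other two. *)
Lemma unexpected_form_side x : x \in rs ->
  unexpected_form.@[(side_vec T x) 0] = 0.
Proof.
move=> xrs; have x0 := root_neq0 N_gt2 rsP xrs.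
move: xrs; rewrite rsP unexpected_formE => /eqP xN.
set u := q0 * _ - _; set w := q1 * 1 - _; set z := q2 * _ - _.
have -> : z = (- (x * u)) + (- (w / x)).
  by rewrite /z /u /w; field.
have -> : u * w = (- (x * u)) * (- (w / x)) by field.
rewrite dickson_power_sum.
have sgn (y : K) : (- y) ^+ N.-1 = - y ^+ N.-1.
  by rewrite exprNn -signr_odd odd_predN expr1 mulN1r.
rewrite !sgn !exprMn exprVn.
have -> : x ^+ N.-1 = x^-1.
  apply: (mulfI x0); rewrite -exprS prednK ?xN ?divff //.
  by rewrite ltnW // ltnW.
by rewrite invrK; ring.
Qed.

Lemma unexpected_form_axis x : x \in rs ->
  unexpected_form.@[(axis_vec T x) 0] = 0.
Proof.
rewrite rsP unexpected_formE => /eqP xN.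
rewrite mul0r addr0 mul1r !mulr0 sub0r subr0 mulr1.
rewrite (_ : q0 * - x = x * - q0); last by ring.
rewrite exprMn mulrA mulNr -exprS prednK; last by rewrite ltnW // ltnW.
by rewrite xN mulN1r subrr.
Qed.

Lemma dim_fat_complete_ge1 (ZZ : set (point K)) :
  complete_polygonal_points T rs ZZ ->
  (0 < \dim (degree_part (fat_ideal ZZ N.-1 P) N))%N.
Proof.
move=> ZP; pose f := DHomog unexpected_form_homog.
have fin : f \in degree_part (fat_ideal ZZ N.-1 P) N.
  apply/(degree_partP _ (subspace_fat_ideal _ _ _)); split; last first.
    exact: unexpected_form_fat.
  apply: (ideal_of_generators (vs := rcons (polygonal_vecs T rs)
    (infinity_vec T))) => [R|w].
    exact: complete_vecsP.
  rewrite mem_rcons inE mem_cat => /orP[/eqP->|/orP[]/mapP[x xrs ->]] /=.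
  - exact: unexpected_form_infinity.
  - exact: unexpected_form_axis.
  - exact: unexpected_form_side.
rewrite lt0n dimv_eq0; apply: contraTneq unexpected_form_neq0 => E.
by move: fin; rewrite E memv0 => /eqP/(congr1 val) /= ->; rewrite eqxx.
Qed.

End UnexpectedCurve.

(** The independence of the conditions makes the expected dimension zero. *)
Lemma complete_unique_unexpected (K : numFieldType) (N : nat) (T : 'M[K]_3)
    (rs : seq K) (Z : set (point K)) :
  T \in unitmx -> (2 < N)%N -> uniq rs -> size rs = N ->
  (forall x, (x \in rs) = (x ^+ N == 1)) -> ~~ odd N ->
  complete_polygonal_points T rs Z ->
  unexpected Z N.-1 /\
  general (fun P => \dim (degree_part (fat_ideal Z N.-1 P) N) = 1%N).
Proof.
move=> T_unit N_gt2 rs_uniq size_rs rsP N_even ZP.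
have N1 : N.-1.+1 = N by rewrite prednK // ltnW // ltnW.
have ge1 : general (fun P => 0 <
    \dim (degree_part (fat_ideal Z N.-1 P) N))%N.
  apply: (@general_off_lines _ [:: vec3 1 0 0 *m (invmx T)^T]) => [c|P w wP].
    rewrite inE => /eqP->; have uT : (invmx T)^T \in unitmx.
      by rewrite unitmx_tr unitmx_inv.
    apply/eqP => /(congr1 (mulmxr (invmx (invmx T)^T))) /=.
    by rewrite mulmxK // mul0mx => /vec3_eq0[/eqP]; rewrite oner_eq0.
  move=> /(_ _ (mem_head _ _)); rewrite -linear_formE -/(coord_form T 1 0 0).
  rewrite coord_formE mul1r !mul0r !addr0 => w0.
  apply: (@dim_fat_complete_ge1 K N T rs T_unit N_gt2 rsP N_even P w _ w0 Z ZP).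
  have [w' w'0 PE] := point_vector P; move: wP; rewrite PE => /vlineP[k wE].
  apply/eqP; rewrite eqEdim !dim_vline w'0 wE.
  have k0 : k != 0.
    by apply: contraNneq w0 => k0; rewrite wE k0 scale0r /frame_coords mul0mx mxE.
  rewrite scaler_eq0 (negbTE k0) (negbTE w'0) -memvE andbT.
  by apply/vlineP; exists k^-1; rewrite scalerK.
have le1 := general_dim_fat_complete T_unit N_gt2 rs_uniq size_rs rsP ZP.
have dimI := complete_conditions_independent T_unit N_gt2 rs_uniq size_rs rsP ZP.
split.
  rewrite /unexpected N1; apply: general_imp ge1 => P.
  by apply: leq_ltn_trans; rewrite leqn0 subn_eq0.
apply: general_imp (general_and ge1 le1) => P [P1 /(_ N.-1)].
rewrite N1 => P2; apply/eqP; rewrite eqn_leq P1 andbT.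
by apply: leq_trans P2 _; lia.
Qed.

(** * Modular points *)

Section Lines.
Variable K : fieldType.

Lemma line_inj (L M : line K) :
  point_vs (dual_point L) = point_vs (dual_point M) -> L = M.
Proof. by case: L M => [P] [Q] /= /val_inj->. Qed.

Lemma dual_configurationE (A : set (line K)) (L : line K) :
  dual_configuration A (dual_point L) <-> A L.
Proof.
split=> [[M AM E]|AL]; last by exists L.
by rewrite (_ : L = M) //; apply: line_inj; rewrite E.
Qed.

Lemma on_lineE (P : point K) (L : line K) (p w : 'rV[K]_3) :
  point_vs P = <[p]>%VS -> point_vs (dual_point L) = <[w]>%VS ->
  on_line P L <-> \sum_i w 0 i * p 0 i = 0.
Proof.
move=> PE LE; split=> [|wp]; first by apply; rewrite ?PE ?LE memv_line.
move=> v u; rewrite PE LE => /vlineP[k ->] /vlineP[l ->].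
transitivity (l * k * \sum_i w 0 i * p 0 i); last by rewrite wp mulr0.
by rewrite mulr_sumr; apply: eq_bigr => i _; rewrite !mxE; ring.
Qed.

End Lines.

Section ModularPoints.
Variables (K : numFieldType) (N : nat) (T : 'M[K]_3) (rs : seq K).
Hypotheses (T_unit : T \in unitmx) (N_gt2 : (2 < N)%N).
Hypotheses (rs_uniq : uniq rs) (size_rs : size rs = N).
Hypothesis rsP : forall x, (x \in rs) = (x ^+ N == 1).

Local Notation side_vec := (side_vec T).
Local Notation axis_vec := (axis_vec T).
Local Notation infinity_vec := (infinity_vec T).

(** The coefficients of the linear form that a point induces on the frame
    coordinates of lines. *)
Definition dual_coords (p : 'rV[K]_3) := p *m T^T.

Lemma on_line_frame (P : point K) (L : line K) (p : 'rV[K]_3) a b c :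
  point_vs P = <[p]>%VS ->
  point_vs (dual_point L) = <[in_frame T a b c]>%VS ->
  on_line P L <-> a * dual_coords p 0 0 + b * dual_coords p 0 1 +
    c * dual_coords p 0 2 = 0.
Proof.
move=> PE LE; rewrite (on_lineE PE LE).
have -> : \sum_i in_frame T a b c 0 i * p 0 i =
    (vec3 a b c *m (dual_coords p)^T) 0 0.
  rewrite /dual_coords trmx_mul trmxK mulmxA mxE.
  by apply: eq_bigr => i _; rewrite [p^T _ _]mxE.
by rewrite mxE sum3 ![(dual_coords p)^T _ _]mxE !vec3E.
Qed.

Lemma point_dual_coords a b c : [|| a != 0, b != 0 | c != 0] ->
  exists (P : point K) p, point_vs P = <[p]>%VS /\ dual_coords p = vec3 a b c.
Proof.
move=> abc; have uT : T^T \in unitmx by rewrite unitmx_tr.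
have [|P PE] := @point_of_vector K (vec3 a b c *m invmx T^T).
  apply: contraTneq abc => /(congr1 (mulmxr T^T)) /=.
  by rewrite mulmxKV // mul0mx => /vec3_eq0[-> -> ->]; rewrite eqxx.
by exists P, (vec3 a b c *m invmx T^T); rewrite /dual_coords mulmxKV.
Qed.

(** The centre is modular: two sides [x] and [y] meet on the axis [1/(x y)], and
    the parallel to the side [x] through the centre has parameter [- 1/x^2],
    which is an [N]-th root of unity when [N] is even. *)
Lemma center_modular (A : set (line K)) :
  polygonal_points T rs (dual_configuration A) \/
    ~~ odd N /\ complete_polygonal_points T rs (dual_configuration A) ->
  supersolvable A.
Proof.
move=> HA.
have ax (L : line K) x : x \in rs ->
    point_vs (dual_point L) = <[axis_vec x]>%VS -> A L.
  move=> xrs LE; apply/dual_configurationE.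
  by case: HA => [HA|[_ HA]]; apply/HA; [|left]; exists x => //; right.
have cases (L : line K) : A L -> [\/ exists2 x, x \in rs &
      point_vs (dual_point L) = <[side_vec x]>%VS,
    exists2 x, x \in rs & point_vs (dual_point L) = <[axis_vec x]>%VS |
    ~~ odd N /\ point_vs (dual_point L) = <[infinity_vec]>%VS].
  move=> /dual_configurationE; case: HA => [HA|[N2 HA]] /HA.
    by case=> x xrs []; [constructor 1|constructor 2]; exists x.
  by case=> [[x xrs []]|]; [constructor 1|constructor 2|constructor 3] => //;
     exists x.
have [|O [o [OE oE]]] := @point_dual_coords 1 0 0; first by rewrite oner_eq0.
have Oax (L : line K) x : point_vs (dual_point L) = <[axis_vec x]>%VS ->
    on_line O L.
  move=> LE; apply/(on_line_frame OE LE).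
  by rewrite oE !vec3E !mulr0 mul0r !addr0.
exists O => Q [L [M [AL AM LM QL QM]]] _.
have [q q0 QE] := point_vector Q.
have via x : x \in rs ->
    dual_coords q 0 1 - x * dual_coords q 0 2 = 0 ->
    exists L, [/\ A L, on_line O L & on_line Q L].
  move=> xrs qx; have [R RE] := @point_of_vector K _ (axis_vec_neq0 T_unit x).
  exists (Line R); split; [exact: (ax _ x)|exact: (Oax _ x)|].
  by apply/(on_line_frame (L := Line R) QE RE); rewrite mul0r add0r mul1r mulNr.
have sideQ (L' : line K) x : point_vs (dual_point L') = <[side_vec x]>%VS ->
    on_line Q L' -> dual_coords q 0 0 + x * dual_coords q 0 1 +
      x^-1 * dual_coords q 0 2 = 0.
  by move=> LE /(on_line_frame QE LE); rewrite mul1r.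
have infQ (L' : line K) : point_vs (dual_point L') = <[infinity_vec]>%VS ->
    on_line Q L' -> dual_coords q 0 0 = 0.
  by move=> LE /(on_line_frame QE LE); rewrite mul1r !mul0r !addr0.
have side_inf (L1 L2 : line K) x : ~~ odd N -> x \in rs ->
    point_vs (dual_point L1) = <[side_vec x]>%VS ->
    point_vs (dual_point L2) = <[infinity_vec]>%VS ->
    on_line Q L1 -> on_line Q L2 ->
    exists L, [/\ A L, on_line O L & on_line Q L].
  move=> N2 xrs L1E L2E /(sideQ _ _ L1E) s1 /(infQ _ L2E) s2.
  have x0 := root_neq0 N_gt2 rsP xrs.
  apply: (via (- x ^- 2)).
    move: xrs; rewrite !rsP exprNn -signr_odd (negbTE N2) expr0 mul1r.
    by rewrite exprVn -exprM mulnC exprM => /eqP->; rewrite expr1n invr1.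
  move: s1; rewrite s2 add0r => s1; apply: (mulfI x0); rewrite mulr0 -s1.
  by field.
case: (cases L AL) => [[x xrs LE]|[x xrs LE]|[N2 LE]].
- case: (cases M AM) => [[y yrs ME]|[y yrs ME]|[N2 ME]].
  + have x0 := root_neq0 N_gt2 rsP xrs; have y0 := root_neq0 N_gt2 rsP yrs.
    have xy : x - y != 0.
      rewrite subr_eq0; apply/eqP => xy; apply: LM; apply: line_inj.
      by rewrite LE ME xy.
    apply: (via (x * y)^-1).
      move: xrs yrs; rewrite !rsP exprVn exprMn => /eqP-> /eqP->.
      by rewrite mulr1 invr1.
    apply: (mulfI xy); rewrite mulr0.
    have := congr2 (fun a b => a - b) (sideQ _ _ LE QL) (sideQ _ _ ME QM).
    by rewrite subr0 => <-; field; rewrite x0 y0.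
  + by exists M; split=> //; apply: Oax ME.
  + exact: side_inf LE ME QL QM.
- by exists L; split=> //; apply: Oax LE.
- case: (cases M AM) => [[y yrs ME]|[y yrs ME]|[_ ME]].
  + exact: side_inf ME LE QM QL.
  + by exists M; split=> //; apply: Oax ME.
  + by case: LM; apply: line_inj; rewrite LE ME.
Qed.

Hypothesis N_odd : odd N.

Lemma root_oppN x : x \in rs -> - x \notin rs.
Proof.
rewrite !rsP exprNn -signr_odd N_odd expr1 => /eqP->.
by rewrite mulr1 eq_sym -subr_eq0 opprK -mulr2n pnatr_eq0.
Qed.

Lemma rootM x y : x \in rs -> y \in rs -> x * y \in rs.
Proof. by rewrite !rsP exprMn => /eqP-> /eqP->; rewrite mulr1. Qed.

Lemma rootV x : x \in rs -> x^-1 \in rs.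
Proof. by rewrite !rsP exprVn => /eqP->; rewrite invr1. Qed.

Lemma root_sqr_inj x y : x \in rs -> y \in rs -> x ^+ 2 = y ^+ 2 -> x = y.
Proof.
move=> xrs yrs /eqP; rewrite eqf_sqr => /orP[/eqP//|/eqP xy].
by have := root_oppN yrs; rewrite -xy xrs.
Qed.

(** A modular point off the line at infinity would be joined to the point at
    infinity of each side [x] by a line of the arrangement; for odd [N] that can
    only be the side itself, but the sides are not concurrent.  A modular point
    on the line at infinity must lie on some axis [z]; it then lies on no side,
    so the intersection of two sides [x] and [y] must be on the axis [z], and
    [x y = 1/z] for all pairs, which three sides contradict. *)
Lemma complete_not_supersolvable (A : set (line K)) :
  complete_polygonal_points T rs (dual_configuration A) -> ~ supersolvable A.
Proof.
move=> HA [P Pmod]; have [p p0 PE] := point_vector P.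
set f0 := dual_coords p 0 0; set f1 := dual_coords p 0 1.
set f2 := dual_coords p 0 2.
have frameP (L : line K) a b c :
    point_vs (dual_point L) = <[in_frame T a b c]>%VS ->
    on_line P L <-> a * f0 + b * f1 + c * f2 = 0.
  exact: on_line_frame PE.
have sideA x : x \in rs -> exists2 L, A L &
    point_vs (dual_point L) = <[side_vec x]>%VS.
  move=> xrs; have [R RE] := @point_of_vector K _ (side_vec_neq0 T_unit x).
  exists (Line R) => //; apply/dual_configurationE/HA; left.
  by exists x => //; left.
have axisA x : x \in rs -> exists2 L, A L &
    point_vs (dual_point L) = <[axis_vec x]>%VS.
  move=> xrs; have [R RE] := @point_of_vector K _ (axis_vec_neq0 T_unit x).
  exists (Line R) => //; apply/dual_configurationE/HA; left.
  by exists x => //; right.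
have infA : exists2 L, A L &
    point_vs (dual_point L) = <[infinity_vec]>%VS.
  have [R RE] := @point_of_vector K _ (infinity_vec_neq0 T_unit).
  by exists (Line R) => //; apply/dual_configurationE/HA; right.
(* the point of intersection of two lines has the cross product as its dual
   coordinates *)
have meet (L M : line K) a b c d e g :
    A L -> A M ->
    point_vs (dual_point L) = <[in_frame T a b c]>%VS ->
    point_vs (dual_point M) = <[in_frame T d e g]>%VS ->
    [|| b * g - c * e != 0, c * d - a * g != 0 | a * e - b * d != 0] ->
    d * f0 + e * f1 + g * f2 != 0 ->
    (exists2 x, x \in rs & f0 + x * f1 + x^-1 * f2 = 0 /\
      (b * g - c * e) + x * (c * d - a * g) + x^-1 * (a * e - b * d) = 0) \/
    (exists2 x, x \in rs & f1 - x * f2 = 0 /\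
      (c * d - a * g) - x * (a * e - b * d) = 0) \/
    (f0 = 0 /\ b * g - c * e = 0).
  move=> AL AM LE ME cr fM.
  have [Q [q [QE qE]]] := point_dual_coords cr.
  have [n [An Pn Qn]] : exists n, [/\ A n, on_line P n & on_line Q n].
    apply: Pmod; last first.
      by move=> QP; move: fM; rewrite ((frameP M d e g ME).1) ?eqxx // -QP;
         apply/(on_line_frame QE ME); rewrite qE !vec3E; ring.
    exists L, M; split=> //.
    - move=> LM; move: cr.
      have /eqP : <[in_frame T a b c]>%VS == <[in_frame T d e g]>%VS.
        by rewrite -LE LM ME.
      have : in_frame T a b c \in <[in_frame T a b c]>%VS by exact: memv_line.
      move=> + E; rewrite E => /vlineP[k]; rewrite in_frameZ.
      move=> /(congr1 (frame_coords T)); rewrite !coords_in_frame // => Ek.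
      have := congr1 (fun v : 'rV_3 => v 0 0) Ek.
      have := congr1 (fun v : 'rV_3 => v 0 1) Ek.
      have := congr1 (fun v : 'rV_3 => v 0 2) Ek.
      rewrite !vec3E => -> -> ->.
      by case/or3P => /eqP[]; ring.
    - by apply/(on_line_frame QE LE); rewrite qE !vec3E; ring.
    - by apply/(on_line_frame QE ME); rewrite qE !vec3E; ring.
  move/dual_configurationE/HA: An => [[x xrs [nE|nE]]|nE].
  - left; exists x => //; split.
      by move/(frameP _ _ _ _ nE): Pn; rewrite mul1r.
    by move/(on_line_frame QE nE): Qn; rewrite qE !vec3E mul1r.
  - right; left; exists x => //; split.
      by move/(frameP _ _ _ _ nE): Pn; rewrite mul0r add0r mul1r mulNr.
    by move/(on_line_frame QE nE): Qn;
       rewrite qE !vec3E mul0r add0r mul1r mulNr.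
  - right; right; split.
      by move/(frameP _ _ _ _ nE): Pn; rewrite mul1r !mul0r !addr0.
    by move/(on_line_frame QE nE): Qn;
       rewrite qE !vec3E mul1r !mul0r !addr0.
have neg_inv x y : x \in rs -> y \in rs -> x^-1 + x * y = 0 -> False.
  move=> xrs yrs E; have x0 := root_neq0 N_gt2 rsP xrs.
  have := root_oppN (rootV xrs).
  have -> : - x^-1 = x * y by apply/eqP; rewrite eq_sym -addr_eq0 addrC E.
  by rewrite rootM.
have [f00|f00] := eqVneq f0 0; last first.
  have sideP x : x \in rs -> f0 + x * f1 + x^-1 * f2 = 0.
    move=> xrs; have x0 := root_neq0 N_gt2 rsP xrs.
    have [L AL LE] := sideA _ xrs; have [M AM ME] := infA.
    case: (meet L M _ _ _ _ _ _ AL AM LE ME) => [||[y yrs [fy]]|[|[]]].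
    - by rewrite !mulr0 !mulr1 !subr0 invr_eq0 x0 !orbT.
    - by rewrite mul1r !mul0r !addr0.
    - have y0 := root_neq0 N_gt2 rsP yrs.
      move=> E; rewrite (_ : x = y) //; apply: root_sqr_inj => //.
      apply/eqP; rewrite -subr_eq0; apply/eqP.
      transitivity (- (x * y) * 0); last by rewrite mulr0.
      by rewrite -E; field; rewrite x0 y0.
    - case=> y yrs [_ E]; exfalso; apply: (neg_inv x y xrs yrs).
      by rewrite -E; ring.
    - by move=> E; rewrite E eqxx in f00.
  have s3 : (2 < size rs)%N by rewrite size_rs.
  have [|_ f0E _] := @quadratic_eq0 K rs f1 f0 f2 rs_uniq s3; last first.
    by rewrite f0E eqxx in f00.
  move=> x xrs; have x0 := root_neq0 N_gt2 rsP xrs.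
  transitivity (x * (f0 + x * f1 + x^-1 * f2)); first by field.
  by rewrite sideP // mulr0.
have [x [y [y' [xrs yrs yrs' [xy xy' yy']]]]] : exists x y y', [/\ x \in rs,
    y \in rs, y' \in rs & [/\ x != y, x != y' & y != y']].
  move: rs_uniq size_rs N_gt2; case: rs => [|x [|y [|y' s]]] => [_ <-|_ <-|_ <-|] //.
  move=> /and3P[]; rewrite !inE !negb_or => /and3P[xy xy' _] /andP[yy' _] _ _ _.
  by exists x, y, y'; rewrite !inE !eqxx ?orbT.
have [z zrs fz] : exists2 z, z \in rs & f1 - z * f2 = 0.
  have [L AL LE] := axisA _ xrs; have [M AM ME] := axisA _ yrs.
  have [fy|fy] := eqVneq (f1 - y * f2) 0; first by exists y.
  have xy0 : x - y != 0 by rewrite subr_eq0.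
  case: (meet L M _ _ _ _ _ _ AL AM LE ME) => [||[s _ [_ E]]|[[s srs []]|[_ E]]].
  - by rewrite mul1r mulr1 opprK addrC xy0.
  - by rewrite mul0r add0r mul1r mulNr.
  - by case/eqP: xy0; rewrite -E; ring.
  - by move=> fs _; exists s.
  - by case/eqP: xy0; rewrite -E; ring.
have f20 : f2 != 0.
  apply: contraNneq p0 => f20; move: fz; rewrite f20 mulr0 subr0 => f10.
  have uT : T^T \in unitmx by rewrite unitmx_tr.
  rewrite -[p](mulmxK uT) -/(dual_coords p) -[dual_coords p]vec3_eta.
  rewrite -/f0 -/f1 -/f2 f00 f10 f20.
  have -> : vec3 0 0 0 = 0 :> 'rV[K]_3 by apply: eq_row3; rewrite vec3E mxE.
  by rewrite mul0mx.
have f1E : f1 = z * f2 by apply/eqP; rewrite -subr_eq0 fz.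
have side0 s : s \in rs -> f0 + s * f1 + s^-1 * f2 != 0.
  move=> srs; rewrite f00 add0r f1E.
  rewrite (_ : _ + _ = (s^-1 + s * z) * f2); last by ring.
  by rewrite mulf_neq0 //; apply/eqP => /(neg_inv _ _ srs zrs).
have key s t : s \in rs -> t \in rs -> s != t -> z * (s * t) = 1.
  move=> srs trs st.
  have s0 := root_neq0 N_gt2 rsP srs; have t0 := root_neq0 N_gt2 rsP trs.
  have ts0 : t - s != 0 by rewrite subr_eq0 eq_sym.
  have [L AL LE] := sideA _ srs; have [M AM ME] := sideA _ trs.
  case: (meet L M _ _ _ _ _ _ AL AM LE ME) => [||[u urs [fu _]]|[[u urs []]|[_ E]]].
  - by rewrite !mul1r !mulr1 ts0 !orbT.
  - by rewrite mul1r side0.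
  - by have := side0 _ urs; rewrite fu eqxx.
  - rewrite f1E -mulrBl => /eqP; rewrite mulf_eq0 (negbTE f20) orbF subr_eq0.
    move=> /eqP <- E; apply/eqP; rewrite eq_sym -subr_eq0; apply/eqP.
    apply: (mulfI ts0); rewrite mulr0; transitivity (s * t * 0).
      by rewrite -E; field; rewrite s0 t0.
    by rewrite mulr0.
  - case/eqP: st; apply: root_sqr_inj => //; apply/eqP.
    rewrite -subr_eq0; apply/eqP; transitivity (s * t * 0); last by rewrite mulr0.
    by rewrite -E; field; rewrite s0 t0.
have z0 := root_neq0 N_gt2 rsP zrs; have x0 := root_neq0 N_gt2 rsP xrs.
case/eqP: yy'; apply: (mulfI x0); apply: (mulfI z0).
by rewrite (key x y) // (key x y').
Qed.

End ModularPoints.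

(** * The regular polygon in its frame *)

Local Open Scope complex_scope.

Section Cis.
Variable R : realType.
Implicit Types x y : R.

Definition cis x : R[i] := cos x +i* sin x.

Lemma cisD x y : cis (x + y) = cis x * cis y.
Proof.
by apply/eqP; rewrite eq_complex /= cosD sinD eqxx /= addrC eqxx.
Qed.

Lemma cis0 : cis 0 = 1.
Proof. by rewrite /cis cos0 sin0. Qed.

Lemma cisMn x n : cis (x *+ n) = cis x ^+ n.
Proof.
elim: n => [|n IH]; first by rewrite mulr0n cis0.
by rewrite mulrS cisD IH exprS.
Qed.

Lemma cis_conj x : cis x * conjc (cis x) = 1.
Proof.
apply/eqP; rewrite eq_complex /= !mulrN opprK -!expr2 cos2Dsin2 eqxx /=.
by rewrite mulrC addNr.
Qed.

Lemma cis_neq0 x : cis x != 0.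
Proof.
by apply: contra_eq_neq (cis_conj x) => ->; rewrite mul0r eq_sym oner_eq0.
Qed.

Lemma conj_cis x : conjc (cis x) = (cis x)^-1.
Proof. by apply: (mulfI (cis_neq0 x)); rewrite cis_conj divff ?cis_neq0. Qed.

Lemma conjcM (a b : R[i]) : conjc (a * b) = conjc a * conjc b.
Proof. exact: rmorphM. Qed.

Lemma conjcB (a b : R[i]) : conjc (a - b) = conjc a - conjc b.
Proof. exact: rmorphB. Qed.

Lemma conjcXn (a : R[i]) n : conjc (a ^+ n) = conjc a ^+ n.
Proof. exact: rmorphXn. Qed.

Lemma cis_neq1 x : 0 < x < pi *+ 2 -> cis x != 1.
Proof.
move=> /andP[x0 x2]; have s0 : 0 < sin (x / 2).
  apply: sin_gt0_pi; rewrite divr_gt0 //= ltr_pdivrMr // mulr_natr //.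
rewrite eq_complex /= negb_and; apply/orP; left.
have -> : x = (x / 2) *+ 2 by rewrite -mulr_natr divfK ?pnatr_eq0.
rewrite cos_mulr2n -subr_eq0.
have -> : cos (x / 2) ^+ 2 *+ 2 - 1 - 1 = - (sin (x / 2) ^+ 2 *+ 2).
  by rewrite cos2sin2; ring.
by rewrite oppr_eq0 mulrn_eq0 /= expf_eq0 /= gt_eqF.
Qed.

End Cis.

Section Polygon.
Variables (R : realType) (N : nat) (c : R * R) (r t : R).
Hypothesis hN : (2 < N)%N.
Local Notation C := R[i].

(* w is a primitive N-th root of unity and h a square root of it; the k-th
   vertex is seen from the centre in the direction tau w^k, the midpoint of the
   k-th side in the direction D w^k *)
Let tau : C := cis t.
Let h : C := cis (pi / N%:R).
Let w : C := h ^+ 2.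
Let D : C := tau * h.
Let rs : seq C := [seq w ^+ k | k <- iota 0 N].

Lemma tau_neq0 : tau != 0. Proof. exact: cis_neq0. Qed.
Lemma h_neq0 : h != 0. Proof. exact: cis_neq0. Qed.
Lemma w_neq0 : w != 0. Proof. by rewrite expf_neq0 // h_neq0. Qed.
Lemma D_neq0 : D != 0. Proof. by rewrite mulf_neq0 ?tau_neq0 ?h_neq0. Qed.

Lemma wE : w = cis (2 * pi / N%:R).
Proof. by rewrite /w /h -cisMn; congr cis; rewrite -[_ *+ 2]mulr_natl mulrA. Qed.

Lemma N_real_neq0 : N%:R != 0 :> R.
Proof. by rewrite pnatr_eq0 -lt0n; apply: ltn_trans hN. Qed.

Lemma w_exp_neq1 k : (0 < k < N)%N -> w ^+ k != 1.
Proof.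
move=> /andP[k0 kN]; rewrite wE -cisMn; apply: cis_neq1.
have N0 : 0 < N%:R :> R by rewrite ltr0n; apply: ltn_trans hN.
rewrite pmulrn_lgt0 // divr_gt0 ?mulr_gt0 ?pi_gt0 //=.
rewrite -[_ *+ k]mulr_natr mulrAC ltr_pdivrMr // -[pi *+ 2]mulr_natl.
by rewrite ltr_pM2l ?ltr_nat // mulr_gt0 ?pi_gt0.
Qed.

Lemma w_expN : w ^+ N = 1.
Proof.
rewrite wE -cisMn -[_ *+ N]mulr_natr divfK ?N_real_neq0 // mulr_natl.
by rewrite /cis cos2pi sin2pi.
Qed.

Lemma roots_uniq : uniq rs.
Proof.
rewrite map_inj_in_uniq ?iota_uniq // => k l; rewrite !mem_iota !add0n /=.
wlog kl : k l / (k <= l)%N => [H|] kN lN E.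
  by case: (leqP k l) => [/H|/ltnW/H]; [apply|move=> /(_ lN kN (esym E))].
apply/eqP; rewrite eqn_leq kl /= leqNgt; apply/negP => lk.
have : w ^+ (l - k) != 1 by apply: w_exp_neq1; lia.
case/eqP; apply: (mulfI (expf_neq0 k w_neq0)).
by rewrite -exprD subnKC // mulr1 E.
Qed.

Lemma size_roots : size rs = N.
Proof. by rewrite size_map size_iota. Qed.

Lemma rootsP x : (x \in rs) = (x ^+ N == 1).
Proof.
rewrite -unity_rootE; symmetry; apply: (@mem_unity_roots _ N rs _ _ _ _ x).
- by apply: ltn_trans hN.
- apply/allP => _ /mapP[k _ ->]; rewrite unity_rootE -exprM mulnC exprM.
  by rewrite w_expN expr1n.
- exact: roots_uniq.
- exact: size_roots.
Qed.

Lemma root_expP x : x \in rs -> exists2 k, (k < N)%N & x = w ^+ k.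
Proof. by case/mapP => k; rewrite mem_iota => kN ->; exists k. Qed.

Lemma w_exp_root k : w ^+ k \in rs.
Proof. by rewrite rootsP -exprM mulnC exprM w_expN expr1n. Qed.

Hypothesis hr : 0 < r.
Let rho : C := r%:C.
Let sigma : C := rho / 2 * (h + h^-1).

Lemma rho_neq0 : rho != 0.
Proof. by rewrite eq_complex /= eqxx andbT gt_eqF. Qed.

(** For the line [p_0 + p_1 x + p_2 y = 0] with frame coordinates [(z, u, v)],
    the value of the equation at the centre is [- sigma z], and [D u] and
    [v / D] are [p_1 + i p_2] and [p_1 - i p_2]; [sigma] is the distance from
    the centre to the sides. *)
Definition frame : 'M[C]_3 := \matrix_i [::
  vec3 (- sigma) 0 0;
  vec3 (- (c.1%:C * (D / 2)) + c.2%:C * ('i * D / 2)) (D / 2) (- ('i * D / 2));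
  vec3 (- (c.1%:C * (D^-1 / 2)) - c.2%:C * ('i * D^-1 / 2))
    (D^-1 / 2) ('i * D^-1 / 2)]`_i.

Lemma in_frameE x y z : in_frame frame x y z =
  let p1 := (y * D + z / D) / 2 in let p2 := 'i * (z / D - y * D) / 2 in
  vec3 (- sigma * x - c.1%:C * p1 - c.2%:C * p2) p1 p2.
Proof.
rewrite /in_frame mulmx_sum_row /= !big_ord_recl big_ord0 addr0 !rowK /= !mxE.
by rewrite /= !vec3Z !vec3D; congr vec3; ring.
Qed.

Lemma mulCii : 'i * 'i = -1 :> C. Proof. by rewrite -expr2 sqr_i. Qed.

Lemma h2_neq1 : h ^+ 2 != 1.
Proof. by have := @w_exp_neq1 1; rewrite expr1; apply; rewrite /= ltnW. Qed.

Lemma sigma_neq0 : sigma != 0.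
Proof.
rewrite !mulf_neq0 ?rho_neq0 ?invr_neq0 ?pnatr_eq0 //.
have -> : h + h^-1 = (w + 1) / h by rewrite /w; field; apply: h_neq0.
rewrite mulf_neq0 ?invr_neq0 ?h_neq0 // addr_eq0.
apply/eqP => wN; have := @w_exp_neq1 2; rewrite wN sqrrN expr1n eqxx => H.
by have := H hN.
Qed.

Lemma frame_unit : frame \in unitmx.
Proof.
rewrite -row_free_unit -kermx_eq0; apply/eqP/row_matrixP => i; rewrite row0.
set v := row i _; have : v *m frame = 0 by apply/sub_kermxP; exact: row_sub.
rewrite -[v]vec3_eta -/(in_frame _ _ _ _) in_frameE /= => /vec3_eq0[E0 E1 E2].
have D0 := D_neq0; have s0 := sigma_neq0.
have Ey : v 0 1 = 0.
  apply: (mulIf D0); rewrite mul0r.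
  transitivity ((v 0 1 * D + v 0 2 / D) / 2 +
      'i * ('i * (v 0 2 / D - v 0 1 * D) / 2)); last by rewrite E1 E2 mulr0 addr0.
  transitivity ((v 0 1 * D + v 0 2 / D) / 2 +
      'i * 'i * ((v 0 2 / D - v 0 1 * D) / 2)); last by ring.
  by rewrite mulCii; field.
have Ez : v 0 2 = 0.
  apply: (mulIf (invr_neq0 D0)); rewrite mul0r.
  by move: E1; rewrite Ey mul0r add0r => /eqP; rewrite mulf_eq0 invr_eq0
    pnatr_eq0 orbF => /eqP.
have Ex : v 0 0 = 0.
  apply: (mulfI s0); rewrite mulr0; apply/eqP; rewrite -oppr_eq0; apply/eqP.
  by rewrite -E0 Ey Ez; ring.
by rewrite Ex Ey Ez; apply: eq_row3; rewrite vec3E mxE.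
Qed.

Definition centered (u : R * R) : C := (u.1 - c.1) +i* (u.2 - c.2).

Lemma centered_inj : injective centered.
Proof. by move=> [a b] [a' b'] [/addIr -> /addIr ->]. Qed.

Lemma i_double (x : C) : 'i * (2 * x * 'i) = - (2 * x).
Proof. by transitivity ('i * 'i * (2 * x)); [ring|rewrite mulCii mulN1r]. Qed.

Lemma centered_fst u :
  u.1%:C = c.1%:C + (centered u + conjc (centered u)) / 2.
Proof.
by rewrite addcJ (mulrC 2) mulfK ?pnatr_eq0 //= -rmorphD subrKC.
Qed.

Lemma centered_snd u :
  u.2%:C = c.2%:C - 'i * (centered u - conjc (centered u)) / 2.
Proof.
rewrite subcJ i_double mulNr opprK (mulrC 2) mulfK ?pnatr_eq0 //= -rmorphD.
by rewrite subrKC.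
Qed.

Lemma centered_vertex k :
  centered (polygon_vertex N c r t k) = rho * tau * w ^+ k.
Proof.
rewrite /centered /polygon_vertex /= ![_ + _ - _]addrAC !subrr !add0r.
rewrite wE -cisMn -[rho * tau * _]mulrA /tau -cisD.
have -> : 2 * pi / N%:R *+ k = 2 * pi * k%:R / N%:R :> R.
  by rewrite -mulr_natr mulrAC.
by apply/eqP; rewrite eq_complex /= !mul0r subr0 addr0 !eqxx.
Qed.

Lemma vertex_on_line k (L : line C) x y z :
  point_vs (dual_point L) = <[in_frame frame x y z]>%VS ->
  on_line (affine_point (polygon_vertex N c r t k)) L <->
  sigma * x = rho / 2 * (y * h / w ^+ k + z * w ^+ k / h).
Proof.
set u := polygon_vertex N c r t k => LE.
have PE : point_vs (affine_point u) = <[vec3 1 u.1%:C u.2%:C]>%VS by [].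
rewrite (on_lineE PE LE) in_frameE sum3 !vec3E mulr1.
have G : centered u = rho * tau * w ^+ k by exact: centered_vertex.
have Gc : conjc (centered u) = rho / (tau * w ^+ k).
  rewrite G !conjcM conjcXn [conjc rho]conjc_real wE !conj_cis.
  by rewrite -mulrA exprVn invfM.
have W0 : w ^+ k != 0 by rewrite expf_neq0 // w_neq0.
have t0 := tau_neq0; have h0 := h_neq0.
rewrite (centered_fst u) (centered_snd u) Gc G.
set lhs := (X in X = 0 <-> _).
have -> : lhs = rho / 2 * (y * h / w ^+ k + z * w ^+ k / h) - sigma * x.
  rewrite /lhs /D.
  transitivity (- sigma * x + (y * (tau * h) + z / (tau * h)) / 2 *
     ((rho * tau * w ^+ k + rho / (tau * w ^+ k)) / 2) -
     ('i * 'i) * (z / (tau * h) - y * (tau * h)) / 2 *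
     ((rho * tau * w ^+ k - rho / (tau * w ^+ k)) / 2)).
    by ring.
  by rewrite mulCii; field; rewrite W0 t0 h0.
by split=> [/subr0_eq->|->]; rewrite ?subrr.
Qed.

(** The equations of [vertex_on_line] for two consecutive vertices determine the
    line up to a scalar. *)
Lemma side_linesE (L : line C) : side_lines N c r t L <->
  exists2 x, x \in rs & point_vs (dual_point L) = <[side_vec frame x]>%VS.
Proof.
have h0 := h_neq0; have hr0 := rho_neq0.
split=> [[k kN [Lk Lk1]]|[x xrs LE]]; last first.
  have [k kN xE] := root_expP xrs; exists k => //.
  have x0 : x != 0 by rewrite xE expf_neq0 // w_neq0.
  split; apply/(vertex_on_line _ LE); rewrite mulr1 /sigma ?exprSr -xE /w.
    by field; rewrite h0 x0.
  by field; rewrite h0 x0.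
have [p p0 LE] := point_vector (dual_point L).
have x0 : w ^+ k != 0 by rewrite expf_neq0 // w_neq0.
exists (w ^+ k); first exact: w_exp_root.
move: LE p0; rewrite -[p](in_frame_coords frame_unit).
set X := frame_coords _ _ _ _; set Y := frame_coords _ _ _ _.
set Z := frame_coords _ _ _ _ => LE p0.
move: Lk Lk1 => /(vertex_on_line _ LE) E0 /(vertex_on_line _ LE).
rewrite exprSr; move: E0; set x := w ^+ k => E0 E1.
have EZ : Z = Y / x ^+ 2.
  apply/eqP; rewrite -subr_eq0.
  have /eqP : (h - h^-1) * x * (rho / 2) * (Z - Y / x ^+ 2) = 0.
    transitivity (sigma * X - sigma * X); last by rewrite subrr.
    by rewrite {1}E1 E0 /w; field; rewrite h0 x0.
  rewrite mulf_eq0 !mulf_eq0 (negbTE x0) (negbTE hr0) invr_eq0 pnatr_eq0 /=.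
  rewrite !orbF => /orP[hh|//]; case/negP: h2_neq1.
  rewrite -subr_eq0 (_ : _ - _ = h * (h - h^-1)); last by field.
  by rewrite (eqP hh) mulr0.
have EX : X = Y / x.
  apply: (mulfI sigma_neq0); rewrite E0 EZ /sigma; field.
  by rewrite h0 x0.
have vE : in_frame frame X Y Z = (Y / x) *: side_vec frame x.
  rewrite in_frameZ EX EZ; congr in_frame; first by rewrite mulr1.
    by field.
  by field.
rewrite LE vE; have Yx0 : Y / x != 0.
  by apply: contraNneq p0 => Yx0; rewrite vE Yx0 scale0r.
apply/eqP; rewrite eqEdim !dim_vline scaler_eq0 (negbTE Yx0) /= leqnn andbT.
by rewrite -memvE memvZ ?memv_line.
Qed.

Section Axis.
Variables a b e : R.
Hypothesis ab : (a, b) <> (0, 0).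
Let n : C := a +i* b.
Let z : C := (e + a * c.1 + b * c.2)%:C.

Lemma sqr_norm_neq0 : a ^+ 2 + b ^+ 2 != 0.
Proof.
rewrite paddr_eq0 ?sqr_ge0 // !expf_eq0 /=; apply/negP => /andP[/eqP a0 /eqP b0].
by apply: ab; rewrite a0 b0.
Qed.

Lemma normal_neq0 : n != 0.
Proof.
rewrite eq_complex /=; apply/negP => /andP[/eqP a0 /eqP b0].
by apply: ab; rewrite a0 b0.
Qed.

Lemma conj_normal_neq0 : conjc n != 0.
Proof. by rewrite conjc_eq0 normal_neq0. Qed.

Lemma real_line_in_frame : vec3 e%:C a%:C b%:C =
  in_frame frame (- (z / sigma)) (n / D) (conjc n * D).
Proof.
have D0 := D_neq0; have s0 := sigma_neq0.
rewrite in_frameE /= !divfK // mulfK //.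
have -> : (n + conjc n) / 2 = a%:C.
  by rewrite addcJ (mulrC 2) mulfK ?pnatr_eq0.
have -> : 'i * (conjc n - n) / 2 = b%:C.
  transitivity (- ('i * (n - conjc n)) / 2); first by ring.
  by rewrite subcJ i_double opprK (mulrC 2) mulfK ?pnatr_eq0.
congr vec3; rewrite mulNr mulrN opprK mulrC divfK // /z.
by apply/eqP; rewrite eq_complex /= !mulr0 !mul0r !(addr0, oppr0, subr0) eqxx
  andbT; apply/eqP; ring.
Qed.

(** Relative to the centre, the reflection is [g |-> - (2 z + n g') / n'], where
    primes denote conjugates. *)
Lemma centered_reflection u :
  centered (reflection a b e u) * conjc n = - (2 * z) - n * conjc (centered u).
Proof.
rewrite /reflection; set s := _ / _.
have sE : s * (a ^+ 2 + b ^+ 2) = 2 * (a * u.1 + b * u.2 + e).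
  by rewrite divfK ?sqr_norm_neq0.
apply/eqP; rewrite eq_complex /=; apply/andP; split; apply/eqP; last by ring.
transitivity (a * (u.1 - c.1) + b * (u.2 - c.2) - s * (a ^+ 2 + b ^+ 2)).
  by ring.
by rewrite sE; ring.
Qed.

End Axis.

Lemma mem_vertices u : polygon_vertices N c r t u <->
  exists2 x, x \in rs & centered u = rho * tau * x.
Proof.
split=> [[k kN <-]|[x /root_expP[k kN ->] E]].
  by exists (w ^+ k); [exact: w_exp_root|exact: centered_vertex].
by exists k => //; apply: centered_inj; rewrite centered_vertex E.
Qed.

Lemma vertex_of_root x : x \in rs ->
  exists2 u, polygon_vertices N c r t u & centered u = rho * tau * x.
Proof.
case/root_expP => k kN ->; exists (polygon_vertex N c r t k).
  by exists k.
exact: centered_vertex.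
Qed.

Lemma conj_root x : x \in rs -> conjc x = x^-1.
Proof. by case/root_expP => k _ ->; rewrite conjcXn wE conj_cis exprVn. Qed.

(** Let [z] be the value of the equation of the axis at the centre.  The image
    of a vertex has the same distance to the centre as the vertex; unless [z]
    vanishes, this is a quadratic equation for the vertex, and it cannot have
    three solutions. *)
Lemma reflection_center a b e : (a, b) <> (0, 0) ->
  reflection a b e @` polygon_vertices N c r t = polygon_vertices N c r t ->
  e + a * c.1 + b * c.2 = 0.
Proof.
move=> ab refl; set n : C := a +i* b; set z := e + _ + _.
have n0 : conjc n != 0 := conj_normal_neq0 ab.
have t0 := tau_neq0; have r0 := rho_neq0.
have quad x : x \in rs ->
    z%:C * (rho * (conjc n * (tau * x) + n / (tau * x)) + 2 * z%:C) = 0.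
  move=> xrs; have x0 : x != 0 by exact: root_neq0 rootsP _ xrs.
  have [u ur uE] := vertex_of_root xrs.
  have : polygon_vertices N c r t (reflection a b e u).
    by rewrite -refl; exists u.
  case/mem_vertices => y yrs vE.
  have y0 : y != 0 by exact: root_neq0 rootsP _ yrs.
  have cj s : s \in rs -> conjc (rho * tau * s) = rho / (tau * s).
    move=> srs; rewrite !conjcM [conjc rho]conjc_real conj_cis conj_root //.
    by rewrite invfM mulrA.
  have E1 := centered_reflection e ab u.
  rewrite vE uE cj // -/n -/z in E1.
  have E2 := congr1 (@conjc R) E1; move: E2.
  rewrite conjcM cj // conjcK.
  have -> : conjc (- (2 * z%:C) - n * (rho / (tau * x))) =
      - (2 * z%:C) - conjc n * (rho * tau * x).
    rewrite -cj // -[- (2 * z%:C)]sub0r.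
    by rewrite !conjcB (conjcM n) (conjcM 2) conjcK conjc0 conjc_nat conjc_real.
  move=> E2.
  have := congr2 *%R E1 E2 => /eqP; rewrite -subr_eq0 => /eqP E.
  apply: (mulfI (_ : 2 != 0 :> C)); first by rewrite pnatr_eq0.
  by rewrite mulr0 -oppr0 -E; field; rewrite x0 y0 t0.
apply/eqP; apply: contraT => z0.
have zC0 : z%:C != 0 by rewrite eq_complex /= eqxx andbT.
have rs3 : (2 < size rs)%N by rewrite size_roots.
have [|A0 _ _] := @quadratic_eq0 C rs (rho * conjc n * tau ^+ 2)
    (2 * z%:C * tau) (rho * n) roots_uniq rs3.
  move=> x xrs; have x0 : x != 0 by exact: root_neq0 rootsP _ xrs.
  apply: (mulfI zC0); rewrite mulr0.
  transitivity (tau * x * (z%:C *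
    (rho * (conjc n * (tau * x) + n / (tau * x)) + 2 * z%:C))).
    by field; rewrite t0 x0.
  by rewrite quad // mulr0.
move/eqP: A0; rewrite !mulf_eq0 (negbTE t0) (negbTE r0).
by rewrite (negbTE n0).
Qed.

(** For an axis through the centre the reflection is [g |-> - (n / n') g'], and
    it maps the first vertex to a vertex exactly when [- n / n'] is [tau^2]
    times an [N]-th root of unity.  It then permutes all vertices. *)
Lemma symmetry_axesE (L : line C) : symmetry_axes N c r t L <->
  exists2 x, x \in rs & point_vs (dual_point L) = <[axis_vec frame x]>%VS.
Proof.
have D0 := D_neq0; have t0 := tau_neq0; have h0 := h_neq0.
have r0 := rho_neq0; have w0 := w_neq0.
split=> [[a [b [e [ab refl LE]]]]|[x xrs LE]].
  have z0 := reflection_center ab refl.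
  set n : C := a +i* b; have n0 : n != 0 := normal_neq0 ab.
  have n'0 : conjc n != 0 := conj_normal_neq0 ab.
  have one : 1 \in rs by rewrite rootsP expr1n.
  have [u ur uE] := vertex_of_root one.
  have : polygon_vertices N c r t (reflection a b e u).
    by rewrite -refl; exists u.
  case/mem_vertices => y yrs vE.
  have y0 : y != 0 by exact: root_neq0 rootsP _ yrs.
  have E1 := centered_reflection e ab u.
  rewrite vE uE z0 mulr1 conjcM [conjc rho]conjc_real conj_cis mulr0 oppr0
    sub0r -/n in E1.
  exists (w / y).
    by move: yrs; rewrite !rootsP exprMn exprVn => /eqP->; rewrite w_expN divr1.
  rewrite LE real_line_in_frame // z0 mul0r oppr0 -/n.
  have -> : in_frame frame 0 (n / D) (conjc n * D) =
      (n / D) *: axis_vec frame (w / y).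
    rewrite in_frameZ mulr0 mulr1; congr in_frame.
    apply: (mulfI r0); apply: (mulfI t0); apply: (mulfI y0).
    transitivity (rho * tau * y * conjc n * D); first by ring.
    by rewrite E1 -/rho -/tau /D /w; field; rewrite y0 t0 h0.
  apply/eqP; rewrite eqEdim -memvE memvZ ?memv_line // !dim_vline.
  by rewrite scaler_eq0 mulf_eq0 invr_eq0 (negbTE n0) (negbTE D0) leqnn.
have [m mN xE] := root_expP xrs; have x0 : x != 0 by rewrite xE expf_neq0.
have hm0 : h ^+ m != 0 by rewrite expf_neq0.
have xm : x = h ^+ m * h ^+ m by rewrite xE /w -exprM mulnC exprM expr2.
pose n : C := 'i * D / h ^+ m.
have n0 : n != 0.
  rewrite !mulf_neq0 ?invr_neq0 //.
  by apply/eqP => i0; have := mulCii; rewrite i0 mul0r => /eqP;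
     rewrite eq_sym oppr_eq0 oner_eq0.
have n'E : conjc n = - ('i * h ^+ m / D).
  rewrite /n /D !conjcM conjc_inv conjcXn !conj_cis.
  have -> : conjc 'i = - 'i :> C by apply/eqP; rewrite eq_complex /= oppr0 !eqxx.
  by rewrite exprVn invrK -/tau -/h; field; rewrite t0 h0.
pose a := complex.Re n; pose b := complex.Im n; pose e := - (a * c.1 + b * c.2).
have nE : n = a +i* b by rewrite /a /b; case: (n).
have ab : (a, b) <> (0, 0).
  by move=> [a0 b0]; case/eqP: n0; rewrite nE a0 b0.
have z0 : e + a * c.1 + b * c.2 = 0 by rewrite /e; ring.
have reflE u x1 : x1 \in rs -> centered u = rho * tau * x1 ->
    centered (reflection a b e u) = rho * tau * (w / (x * x1)).
  move=> x1rs uE; have x10 : x1 != 0 by exact: root_neq0 rootsP _ x1rs.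
  have n'0 : conjc n != 0 by rewrite conjc_eq0.
  apply: (mulIf n'0); rewrite {1}nE centered_reflection // z0 mulr0 oppr0.
  rewrite sub0r -nE n'E uE !conjcM [conjc rho]conjc_real conj_cis conj_root //.
  rewrite -/rho -/tau /n xm /D /w; field.
  by rewrite t0 h0 x10 hm0.
have rsI x1 : x1 \in rs -> w / (x * x1) \in rs.
  move: xrs; rewrite !rootsP exprMn w_expN exprVn exprMn => /eqP-> /eqP->.
  by rewrite mulr1 divr1.
exists a, b, e; split=> //.
  apply/seteqP; split=> [_ [u /mem_vertices[x1 x1rs uE] <-]|u].
    apply/mem_vertices; exists (w / (x * x1)); first exact: rsI.
    exact: reflE.
  case/mem_vertices => x1 x1rs uE.
  have x10 : x1 != 0 by exact: root_neq0 rootsP _ x1rs.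
  have [v vr vE] := vertex_of_root (rsI _ x1rs); exists v => //.
  apply: centered_inj; rewrite (reflE _ _ (rsI _ x1rs) vE) uE.
  by field; rewrite x0 x10 w0.
rewrite LE real_line_in_frame // z0 mul0r oppr0 -nE n'E.
have -> : in_frame frame 0 (n / D) (- ('i * h ^+ m / D) * D) =
    ('i / h ^+ m) *: axis_vec frame x.
  by rewrite in_frameZ mulr0 mulr1 xm /n; congr in_frame; field;
     rewrite ?D0 ?hm0.
have k0 : 'i / h ^+ m != 0.
  by move: n0; rewrite /n !mulf_eq0 !negb_or => /andP[/andP[-> _] ->].
apply/eqP; rewrite eq_sym eqEdim -memvE memvZ ?memv_line // !dim_vline.
by rewrite scaler_eq0 (negbTE k0) leqnn.
Qed.

Lemma polygonal_dual :
  polygonal_points frame rs (dual_configuration (polygonal N c r t)).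
Proof.
move=> P; rewrite -[P]/(dual_point (Line P)) dual_configurationE.
split=> [[/side_linesE|/symmetry_axesE] [x xrs E]|[x xrs [E|E]]].
- by exists x => //; left.
- by exists x => //; right.
- by left; apply/side_linesE; exists x.
- by right; apply/symmetry_axesE; exists x.
Qed.

Lemma complete_polygonal_dual :
  complete_polygonal_points frame rs
    (dual_configuration (complete_polygonal N c r t)).
Proof.
have infE : <[infinity_vec frame]>%VS = <[vec3 1 0 0]>%VS :> {vspace 'rV[C]_3}.
  have -> : infinity_vec frame = (- sigma) *: vec3 1 0 0.
    by rewrite /infinity_vec in_frameE /= vec3Z; congr vec3; ring.
  have s0 : - sigma != 0 by rewrite oppr_eq0 sigma_neq0.
  apply/eqP; rewrite eqEdim -memvE memvZ ?memv_line // !dim_vline.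
  by rewrite scaler_eq0 (negbTE s0) leqnn.
move=> P; have := polygonal_dual P.
rewrite -[P]/(dual_point (Line P)) !dual_configurationE => PE.
split=> [[/PE|LE]|[/PE|LE]]; first by left.
- by right; rewrite infE.
- by left.
- by right; rewrite /line_at_infinity /= -infE.
Qed.

End Polygon.

(** * Supersolvability and unexpected curves of polygonal arrangements *)

Theorem theorem3p15 (R : realType) (N : nat) (c : R * R) (r t : R)
    (hN : (2 < N)%N) (hr : 0 < r) :
  [/\ supersolvable (polygonal N c r t),
      supersolvable (complete_polygonal N c r t) <-> ~~ odd N,
      ~ admits_unexpected (polygonal N c r t) &
      ~~ odd N -> admits_unique_unexpected (complete_polygonal N c r t) N].
Proof.
have T_unit := frame_unit c t hN hr.
have rs_uniq := @roots_uniq R N hN; have rsP := @rootsP R N hN.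
have rs_size := @size_roots R N.
have P_dual := polygonal_dual c t hN hr.
have Pbar_dual := complete_polygonal_dual c t hN hr.
split.
- by apply: (center_modular T_unit hN rsP); left.
- split=> [ss|N2]; last by apply: (center_modular T_unit hN rsP); right.
  apply/negP => N1.
  exact: (complete_not_supersolvable T_unit hN rs_uniq rs_size rsP N1 Pbar_dual).
- move=> [_ [j _]].
  exact: (polygonal_not_unexpected T_unit hN rs_uniq rs_size P_dual).
- move=> N2; have N1 : N.-1.+1 = N by rewrite prednK // ltnW // ltnW.
  have [unex dim1] :=
    complete_unique_unexpected T_unit hN rs_uniq rs_size rsP N2 Pbar_dual.
  split=> // d; split=> [[j -> ]|->]; last by exists N.-1.
  exact: (complete_unexpected_degree T_unit hN rs_uniq rs_size rsP Pbar_dual).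
Qed.
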